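(* Let $M$ be an $L$-structure and $\partial: D(M)\rightarrow M$ a function such that $N=(M, D(M), D(M^{2}), \ldots, \partial)$ is a model of ${\tt ABL}_{0}$ (respectively ${\tt AHP}_{0}$, reading $\partial$ as $\#$). Let $B\in 2^{\omega}$. Then: (i) If $\partial$ is uniformly definable and $M$ is saturated, then $N$ models ${\tt \Delta^{1}_{1}\text{-}BL}_{0}$ (resp. ${\tt \Delta^{1}_{1}\text{-}HP}_{0}$). (ii) If $\partial$ is uniformly definable and $M$ is saturated, then $N$ models ${\tt \Sigma^{1}_{1}\text{-}LB}_{0}$ (resp. ${\tt \Sigma^{1}_{1}\text{-}PH}_{0}$) if and only if $M$ has definable skolem functions. (iii) If $\partial$ is $B$-computably uniformly definable and $M$ is $B$-recursively saturated, then $N$ models ${\tt \Delta^{1}_{1}\text{-}BL}_{0}$ (resp. ${\tt \Delta^{1}_{1}\text{-}HP}_{0}$). (iv) If $\partial$ is $B$-computably uniformly definable and $M$ is $B$-recursively saturated, then $N$ models ${\tt \Sigma^{1}_{1}\text{-}LB}_{0}$ (resp. ${\tt \Sigma^{1}_{1}\text{-}PH}_{0}$) if and only if $M$ has definable skolem functions.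
   Context: $D(M^n)$ is the set of subsets of $M^n$ definable in $M$ with parameters; $(M,D(M),D(M^2),\ldots,\partial)$ is the many-sorted structure with objects $M$, $n$-ary relations $D(M^n)$ (elements of $D(M)$ are sets), and $\partial:D(M)\to M$. Theories: Basic Law V is $\partial X=\partial Y\leftrightarrow X=Y$; Hume's Principle is $\#X=\#Y\leftrightarrow$ there is a bijection $f:X\to Y$ (graph a binary relation of the structure). Formula hierarchy: arithmetical formulas have no bound relation variables (may contain the function symbol); $\Sigma^1_n/\Pi^1_n$ built by blocks of existential/universal relation quantifiers of any arity. ${\tt ABL}_0$ (${\tt AHP}_0$): the axiom plus comprehension $\exists R\forall\bar n[\bar n\in R\leftrightarrow\varphi(\bar n)]$ for arithmetical $\varphi$ (with parameters). ${\tt \Delta^1_1\text{-}BL}_0$ (${\tt \Delta^1_1\text{-}HP}_0$): the axiom plus, for $\Sigma^1_1$ $\varphi$ and $\Pi^1_1$ $\psi$, $[\forall\bar n(\varphi(\bar n)\leftrightarrow\psi(\bar n))]\to\exists R\forall\bar n[\bar n\in R\leftrightarrow\varphi(\bar n)]$. ${\tt \Sigma^1_1\text{-}LB}_0$ (${\tt \Sigma^1_1\text{-}PH}_0$): ${\tt ABL}_0$ (${\tt AHP}_0$) plus $[\forall \bar n\,\exists P\,\varphi(\bar n,P)]\rightarrow[\exists R\,\forall \bar n\,\forall P\,(\forall \bar m\,(\bar m\in P\leftrightarrow \bar n\bar m\in R))\rightarrow \varphi(\bar n,P)]$ for $\Sigma^1_1$ $\varphi$. $\partial:D(M)\to M$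 is uniformly definable if for every $L$-formula $\theta(x,\bar y)$ with nonempty tuple $\bar y$ of parameter variables there is an $L$-formula $\theta'(x,\bar y)$ such that for all $\bar a,b\in M$: $\partial(\theta(\cdot,\bar a))=b\iff M\models\theta'(b,\bar a)$. For countable $L$, it is $B$-computably uniformly definable if moreover the map $\theta\mapsto\theta'$ is $B$-computable. $M$ has definable skolem functions if for every definable $P\subseteq M^{m+n}$ there is a definable (parameters allowed) $P'\subseteq M^{m+n}$ with $M\models\forall\bar x\bar y(P'\bar x\bar y\to P\bar x\bar y)$ and $M\models\forall\bar x[\exists\bar y P\bar x\bar y\to\exists!\bar y P'\bar x\bar y]$. $M$ is saturated if every set of formulas in finitely many variables with parameters from a set $A$ with $|A|<|M|$ that is finitely realized in $M$ is realized. For countable $L$ and $M$, $M$ is $B$-recursively saturated if every $B$-computable set of formulas with parameters from a finite $A\subseteq M$, in finitely many variables, finitely realized in $M$, is realized in $M$. *)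

(* Defs.v *)
From mathcomp Require Import all_boot.
From mathcomp Require Import boolp classical_sets functions cardinality.

Set Implicit Arguments.
Unset Strict Implicit.
Unset Printing Implicit Defensive.

Local Open Scope classical_set_scope.
Local Open Scope card_scope.

(** * First-order logic *)

(* Constants are function symbols of arity 0. *)
Record language := Language {
  fsym : Type;
  far : fsym -> nat;
  rsym : Type;
  rar : rsym -> nat }.

Inductive term (L : language) : Type :=
| TVar of nat
| TApp (f : fsym L) of ('I_(far f) -> term L).

Inductive formula (L : language) : Type :=
| FEq of term L & term L
| FRel (r : rsym L) of (rar r).-tuple (term L)
| FNot of formula L
| FAnd of formula L & formula L
| FEx of nat & formula L.

Arguments TVar {L} _.

Fixpoint term_fv L (t : term L) : seq nat :=
  match t with
  | TVar i => [:: i]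
  | TApp f ts => flatten [seq term_fv (ts i) | i <- enum 'I_(far f)]
  end.

Fixpoint fv L (phi : formula L) : seq nat :=
  match phi with
  | FEq s t => term_fv s ++ term_fv t
  | FRel r ts => flatten [seq term_fv t | t <- ts]
  | FNot p => fv p
  | FAnd p q => fv p ++ fv q
  | FEx i p => [seq j <- fv p | j != i]
  end.

Record structure (L : language) := Structure {
  carrier :> Type;
  carrier_inh : inhabited carrier;
  fint : forall f : fsym L, (far f).-tuple carrier -> carrier;
  rint : forall r : rsym L, set ((rar r).-tuple carrier) }.

Fixpoint term_eval L (M : structure L) (e : nat -> M) (t : term L) : M :=
  match t with
  | TVar i => e i
  | TApp f ts => fint [tuple term_eval e (ts i) | i < far f]
  end.

Fixpoint sat L (M : structure L) (e : nat -> M) (phi : formula L) : Prop :=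
  match phi with
  | FEq s t => term_eval e s = term_eval e t
  | FRel r ts => rint (map_tuple (term_eval e) ts)
  | FNot p => ~ sat e p
  | FAnd p q => sat e p /\ sat e q
  | FEx i p => exists a : M, sat [eta e with i |-> a] p
  end.

(* The tuple x is assigned to the variables v_0, ..., v_(n-1), and v_i is
   assigned e i for i >= n. Throughout, v_0, ..., v_(n-1) play the role of the
   displayed variables of a formula, and the values e i, i >= n, play the role
   of its parameters. *)
Definition assign (T : Type) n (x : n.-tuple T) (e : nat -> T) : nat -> T :=
  fun i => nth (e i) x i.

Definition defset L (M : structure L) n (theta : formula L) (e : nat -> M) :
  set (n.-tuple M) := [set x | sat (assign x e) theta].
Arguments defset {L M} n theta e.

Definition D L (M : structure L) n : set (set (n.-tuple M)) :=
  [set X | exists theta e, X = defset n theta e].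

Lemma D_defset L (M : structure L) n (theta : formula L) (e : nat -> M) :
  D (defset n theta e).
Proof. by exists theta, e. Qed.

Definition defcut L (M : structure L) n (theta : formula L) (e : nat -> M) :
  {X : set (n.-tuple M) | D X} := exist _ (defset n theta e) (D_defset n theta e).

Definition definable_skolem L (M : structure L) : Prop :=
  forall m n (P : set ((m + n).-tuple M)), D P ->
  exists P' : set ((m + n).-tuple M),
    [/\ D P',
        forall (x : m.-tuple M) (y : n.-tuple M),
          P' (cat_tuple x y) -> P (cat_tuple x y) &
        forall x : m.-tuple M,
          (exists y : n.-tuple M, P (cat_tuple x y)) ->
          exists! y : n.-tuple M, P' (cat_tuple x y)].

(* A formula with parameters in the variables v_0, ..., v_(n-1) is a pair
   (phi, e), where e gives the parameters standing for the other free variables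
   of phi. *)
Definition realizes L (M : structure L) n (x : n.-tuple M)
  (phie : formula L * (nat -> M)) : Prop := sat (assign x phie.2) phie.1.

Definition realized L (M : structure L) n
  (p : set (formula L * (nat -> M))) : Prop :=
  exists x : n.-tuple M, forall phie, p phie -> realizes x phie.

Definition finitely_realized L (M : structure L) n
  (p : set (formula L * (nat -> M))) : Prop :=
  forall q : set (formula L * (nat -> M)),
    finite_set q -> q `<=` p -> realized n q.

Definition saturated L (M : structure L) : Prop :=
  forall A : set M, A #<= [set: M] -> A #!= [set: M] ->
  forall n (p : set (formula L * (nat -> M))),
    (forall phi e, p (phi, e) -> forall i, i \in fv phi -> n <= i -> A (e i)) ->
    finitely_realized n p -> realized n p.

(** * Computability relative to an oracle *)

(* The total functions computable in B are the least class of functions that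
   contains the initial functions and B and is closed under composition,
   primitive recursion and minimization of regular functions. *)
Inductive computable_in (B : nat -> bool) :
  forall n, (n.-tuple nat -> nat) -> Prop :=
| comp_zero : computable_in B (fun _ : 0.-tuple nat => 0)
| comp_succ : computable_in B (fun x : 1.-tuple nat => (thead x).+1)
| comp_oracle : computable_in B (fun x : 1.-tuple nat => nat_of_bool (B (thead x)))
| comp_proj n (i : 'I_n) : computable_in B (fun x : n.-tuple nat => tnth x i)
| comp_comp m n (f : m.-tuple nat -> nat) (g : 'I_m -> n.-tuple nat -> nat) :
    computable_in B f -> (forall i, computable_in B (g i)) ->
    computable_in B (fun x : n.-tuple nat => f [tuple g i x | i < m])
| comp_prec n (f : n.-tuple nat -> nat) (g : n.+2.-tuple nat -> nat) :
    computable_in B f -> computable_in B g ->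
    computable_in B (fun x : n.+1.-tuple nat =>
      iteri (thead x)
        (fun k r => g (cons_tuple k (cons_tuple r (behead_tuple x))))
        (f (behead_tuple x)))
| comp_min n (f : n.+1.-tuple nat -> nat)
    (reg : forall x : n.-tuple nat, exists y, f (cons_tuple y x) == 0) :
    computable_in B f ->
    computable_in B (fun x : n.-tuple nat => ex_minn (reg x)).

(* A numbering of the symbols of a (necessarily countable) language, with
   respect to which it is decidable in B which numbers denote symbols and what
   their arities are. *)
Record numbering (B : nat -> bool) (L : language) := Numbering {
  fnum : fsym L -> nat;
  rnum : rsym L -> nat;
  fnum_inj : injective fnum;
  rnum_inj : injective rnum;
  fnum_comp : exists2 a : 1.-tuple nat -> nat, computable_in B a &
    (forall f, a [tuple fnum f] = (far f).+1) /\
    (forall k, a [tuple k] != 0 -> exists f, fnum f = k);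
  rnum_comp : exists2 a : 1.-tuple nat -> nat, computable_in B a &
    (forall r, a [tuple rnum r] = (rar r).+1) /\
    (forall k, a [tuple k] != 0 -> exists r, rnum r = k) }.

Fixpoint term_num B L (c : numbering B L) (t : term L) : nat :=
  match t with
  | TVar i => CodeSeq.code [:: 0; i]
  | TApp f ts => CodeSeq.code
      [:: 1, fnum c f & [seq term_num c (ts i) | i <- enum 'I_(far f)]]
  end.

Fixpoint form_num B L (c : numbering B L) (phi : formula L) : nat :=
  match phi with
  | FEq s t => CodeSeq.code [:: 0; term_num c s; term_num c t]
  | FRel r ts => CodeSeq.code
      [:: 1, rnum c r & [seq term_num c t | t <- ts]]
  | FNot p => CodeSeq.code [:: 2; form_num c p]
  | FAnd p q => CodeSeq.code [:: 3; form_num c p; form_num c q]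
  | FEx i p => CodeSeq.code [:: 4; i; form_num c p]
  end.

Definition computable_map B L (c : numbering B L)
  (F : formula L -> formula L) : Prop :=
  exists2 g : 1.-tuple nat -> nat, computable_in B g &
    forall phi, g [tuple form_num c phi] = form_num c (F phi).

Definition computable_set B L (c : numbering B L) (p : set (formula L)) : Prop :=
  exists2 chi : 1.-tuple nat -> nat, computable_in B chi &
    forall k, chi [tuple k] != 0 <-> exists2 phi, p phi & form_num c phi = k.

(* The finitely many parameters are e n, ..., e (m - 1). *)
Definition rec_saturated B L (c : numbering B L) (M : structure L) : Prop :=
  countable [set: M] /\
  forall n m (e : nat -> M) (p : set (formula L)),
    computable_set c p ->
    (forall phi, p phi -> forall i, i \in fv phi -> i < m) ->
    let pe := [set phie | p phie.1 /\ phie.2 = e] in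
    finitely_realized n pe -> realized n pe.

(** * Uniform definability *)

(* theta (x, y_1, ..., y_(k+1)) is a formula with x = v_0 and y_i = v_i. *)
Definition unif_defines L (M : structure L)
  (d : {X : set (1.-tuple M) | D X} -> M) (theta theta' : formula L) : Prop :=
  forall (e : nat -> M) (b : M),
    d (defcut 1 theta e) = b <-> sat [eta e with 0 |-> b] theta'.

Definition unif_definable L (M : structure L)
  (d : {X : set (1.-tuple M) | D X} -> M) : Prop :=
  forall k (theta : formula L), (forall i, i \in fv theta -> i < k.+2) ->
  exists2 theta' : formula L, (forall i, i \in fv theta' -> i < k.+2) &
    unif_defines d theta theta'.

Definition comp_unif_definable B L (c : numbering B L) (M : structure L)
  (d : {X : set (1.-tuple M) | D X} -> M) : Prop :=
  exists2 F : formula L -> formula L, computable_map c F &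
  forall k (theta : formula L), (forall i, i \in fv theta -> i < k.+2) ->
    (forall i, i \in fv (F theta) -> i < k.+2) /\ unif_defines d theta (F theta).

(** * Second-order structures, formulas and theories *)

(* All relations have positive arity: index n stands for arity n.+1. *)
Record so_structure := SOStructure {
  obj :> Type;
  rels : forall n, set (set (n.+1.-tuple obj));
  abstr : {X : set (1.-tuple obj) | rels (n := 0) X} -> obj }.

Definition rel_of (N : so_structure) n := {X : set (n.+1.-tuple N) | rels X}.

Definition so_of L (M : structure L) (d : {X : set (1.-tuple M) | D X} -> M) :
  so_structure := @SOStructure M (fun n => @D L M n.+1) d.

(* Object variables are numbered by nat, and so are the relation variables of
   each arity; SAbs j is the function symbol applied to the j-th unary relation
   variable. *)
Inductive so_term := SVar of nat | SAbs of nat.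

Inductive so_formula :=
| SEq of so_term & so_term
| SEqR (n : nat) of nat & nat
| SMem n of nat & n.+1.-tuple so_term
| SNot of so_formula
| SAnd of so_formula & so_formula
| SEx of nat & so_formula
| SExR (n : nat) of nat & so_formula
| SAllR (n : nat) of nat & so_formula.

Definition so_eval (N : so_structure) (e : nat -> N)
  (E : forall n, nat -> rel_of N n) (t : so_term) : N :=
  match t with SVar i => e i | SAbs j => abstr (E 0 j) end.

Definition set_rel (N : so_structure) (E : forall n, nat -> rel_of N n)
  n (j : nat) (P : rel_of N n) : forall n, nat -> rel_of N n :=
  dfwith E (fun i => if i == j then P else E n i).

Fixpoint so_sat (N : so_structure) (e : nat -> N)
  (E : forall n, nat -> rel_of N n) (phi : so_formula) : Prop :=
  match phi with
  | SEq s t => so_eval e E s = so_eval e E t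
  | SEqR n i j => sval (E n i) = sval (E n j)
  | SMem n j ts => sval (E n j) (map_tuple (so_eval e E) ts)
  | SNot p => ~ so_sat e E p
  | SAnd p q => so_sat e E p /\ so_sat e E q
  | SEx i p => exists a : N, so_sat [eta e with i |-> a] E p
  | SExR n j p => exists P : rel_of N n, so_sat e (set_rel E j P) p
  | SAllR n j p => forall P : rel_of N n, so_sat e (set_rel E j P) p
  end.

Fixpoint arithmetical (phi : so_formula) : Prop :=
  match phi with
  | SEq _ _ | SEqR _ _ _ | SMem _ _ _ => True
  | SNot p | SEx _ p => arithmetical p
  | SAnd p q => arithmetical p /\ arithmetical q
  | SExR _ _ _ | SAllR _ _ _ => False
  end.

Inductive Sigma11 : so_formula -> Prop :=
| Sigma11_arith phi : arithmetical phi -> Sigma11 phi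
| Sigma11_ex n j phi : Sigma11 phi -> Sigma11 (SExR n j phi).

Inductive Pi11 : so_formula -> Prop :=
| Pi11_arith phi : arithmetical phi -> Pi11 phi
| Pi11_all n j phi : Pi11 phi -> Pi11 (SAllR n j phi).

Definition basic_law_V (N : so_structure) : Prop :=
  forall X Y : rel_of N 0, abstr X = abstr Y <-> sval X = sval Y.

Definition bijection_graph (T : Type) (f : set (2.-tuple T))
  (X Y : set (1.-tuple T)) : Prop :=
  [/\ forall a b, f [tuple a; b] -> X [tuple a] /\ Y [tuple b],
      forall a, X [tuple a] -> exists! b, f [tuple a; b] &
      forall b, Y [tuple b] -> exists! a, f [tuple a; b]].

Definition hume_principle (N : so_structure) : Prop :=
  forall X Y : rel_of N 0, abstr X = abstr Y <->
    exists f : rel_of N 1, bijection_graph (sval f) (sval X) (sval Y).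

Definition arith_comprehension (N : so_structure) : Prop :=
  forall phi, arithmetical phi ->
  forall (e : nat -> N) (E : forall n, nat -> rel_of N n) k,
  exists R : rel_of N k, forall x : k.+1.-tuple N,
    sval R x <-> so_sat (assign x e) E phi.

Definition Delta11_comprehension (N : so_structure) : Prop :=
  forall phi psi, Sigma11 phi -> Pi11 psi ->
  forall (e : nat -> N) (E : forall n, nat -> rel_of N n) k,
  (forall x : k.+1.-tuple N,
    so_sat (assign x e) E phi <-> so_sat (assign x e) E psi) ->
  exists R : rel_of N k, forall x : k.+1.-tuple N,
    sval R x <-> so_sat (assign x e) E phi.

(* In phi (x, P), the variable P is the relation variable number 0 of arity
   m.+1. The type of R uses that k.+1 + m.+1 is convertible to
   (k + m.+1).+1. *)
Definition Sigma11_choice (N : so_structure) : Prop :=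
  forall phi, Sigma11 phi ->
  forall (e : nat -> N) (E : forall n, nat -> rel_of N n) k m,
  (forall x : k.+1.-tuple N, exists P : rel_of N m,
    so_sat (assign x e) (set_rel E 0 P) phi) ->
  exists R : rel_of N (k + m.+1),
    forall (x : k.+1.-tuple N) (P : rel_of N m),
    (forall y : m.+1.-tuple N, sval P y <-> sval R (cat_tuple x y)) ->
    so_sat (assign x e) (set_rel E 0 P) phi.

Definition ABL0 N := basic_law_V N /\ arith_comprehension N.
Definition AHP0 N := hume_principle N /\ arith_comprehension N.
Definition Delta11_BL0 N := basic_law_V N /\ Delta11_comprehension N.
Definition Delta11_HP0 N := hume_principle N /\ Delta11_comprehension N.
Definition Sigma11_LB0 N := ABL0 N /\ Sigma11_choice N.
Definition Sigma11_PH0 N := AHP0 N /\ Sigma11_choice N.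

(* Main.v *)
(** Fix tuples of L-formulas theta for the bound relation variables of a
Sigma^1_1 formula. Uniform definability of the abstraction operator turns "some
relations defined by theta, with some parameters, are witnesses at x" into an
L-formula p_theta(x), so that the Sigma^1_1 formula is the disjunction of all
the p_theta. When x satisfies either a Sigma^1_1 formula or the negation of a
Pi^1_1 formula equivalent to it, saturation makes finitely many p_theta and
their counterparts for the negation suffice, and a finite disjunction of p_theta
defines the set. For choice, finitely many theta suffice again, and Skolem
functions select the parameters; conversely, choice applied to "P is a singleton
inside the fibre over x whenever the fibre is nonempty" gives Skolem functions.
In the recursively saturated case the formulas p_theta form a computable
sequence, which Craig's trick turns into a computable set. *)

Require Import Defs.
From mathcomp Require Import all_boot zify.
From mathcomp Require Import boolp classical_sets functions cardinality.

Set Implicit Arguments.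
Unset Strict Implicit.
Unset Printing Implicit Defensive.

Local Open Scope classical_set_scope.
Local Open Scope card_scope.

(** * Definability in a first-order structure *)

(** In the recursively saturated case the passage from theta to p_theta must be computable, and
    substituting variables inside theta would make this laborious. So no substitution is made in
    theta: its parameters are expected in variables from a bound [K1] on, the variables between its
    displayed ones and [K1] are quantified away, and atomic formulas are translated by copying
    values between variables under quantifiers. Renaming is applied only to single formulas, to show
    that every finite tuple of definable relations has definitions of this form. Both kinds of
    saturation then enter only through [uniform]: closure of families under the logical operations,
    an enumeration of all finite tuples of formulas, definability of the abstraction operator, and
    compactness. One index [w] stands for the whole tuple theta, since the quantifiers of a
    Sigma^1_1 prefix may need different formulas as witnesses. *)

Lemma seq_ub (s : seq nat) : exists K, forall i, i \in s -> i < K.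
Proof.
exists (\max_(i <- s) i).+1 => i si; rewrite ltnS.
by rewrite (leq_bigmax_seq (P := predT) (F := id)).
Qed.

Lemma term_eval_fv L (M : structure L) (e e' : nat -> M) t :
  (forall i, i \in term_fv t -> e i = e' i) -> term_eval e t = term_eval e' t.
Proof.
elim: t => [i|f ts IH] /= h; first by apply: h; rewrite inE.
congr fint; apply: eq_mktuple => i; apply: IH => j jin; apply: h.
by apply/flatten_mapP; exists i => //; rewrite mem_enum.
Qed.

Lemma sat_fv L (M : structure L) (phi : formula L) (e e' : nat -> M) :
  (forall i, i \in fv phi -> e i = e' i) -> sat e phi <-> sat e' phi.
Proof.
elim: phi e e' => [s t|r ts|p IH|p IHp q IHq|i p IH] e e' /= h.
- rewrite (@term_eval_fv _ _ e e' s) ?(@term_eval_fv _ _ e e' t)// => i it;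
    by apply: h; rewrite mem_cat it ?orbT.
- suff -> : map_tuple (term_eval e) ts = map_tuple (term_eval e') ts by [].
  apply/val_inj => /=; elim: (val ts) h => //= t s IH h.
  by congr cons; [apply: term_eval_fv|apply: IH] => i it; apply: h;
    rewrite mem_cat it ?orbT.
- by rewrite (IH e e').
- by rewrite (IHp e e') ?(IHq e e')// => i it; apply: h; rewrite mem_cat it ?orbT.
- suff E a : sat [eta e with i |-> a] p <-> sat [eta e' with i |-> a] p.
    by split=> -[a] /E H; exists a.
  apply: IH => j jp /=; case: eqVneq => // ji.
  by rewrite h// mem_filter ji.
Qed.

Fixpoint term_ren L (s : nat -> nat) (t : term L) : term L :=
  match t with
  | TVar i => TVar (s i)
  | TApp f ts => TApp (fun i => term_ren s (ts i))
  end.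

Lemma term_eval_ren L (M : structure L) (e : nat -> M) s t :
  term_eval e (term_ren s t) = term_eval (e \o s) t.
Proof.
by elim: t => //= f ts IH; congr fint; apply: eq_mktuple => i; apply: IH.
Qed.

Lemma term_fv_ren L s (t : term L) : term_fv (term_ren s t) = map s (term_fv t).
Proof.
elim: t => //= f ts IH; rewrite map_flatten -map_comp.
by congr flatten; apply: eq_map => i /=; rewrite IH.
Qed.

(** [s] may identify variables, so bound variables have to be renamed as well. Only existence is
    stated: renaming is applied to single formulas, never to a family that has to be computable. *)
Lemma sat_ren L (M : structure L) (phi : formula L) (s : nat -> nat) :
  exists psi : formula L,
    (forall j, j \in fv psi -> exists2 i, i \in fv phi & j = s i) /\
    forall e : nat -> M, sat e psi <-> sat (e \o s) phi.
Proof.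
elim: phi s => [t u|r ts|p IH|p IHp q IHq|i p IH] s.
- exists (FEq (term_ren s t) (term_ren s u)); split=> [j|e] /=; last first.
    by rewrite !term_eval_ren.
  by rewrite !term_fv_ren -map_cat => /mapP.
- exists (FRel (map_tuple (term_ren s) ts)); split=> [j|e] /=.
    rewrite -map_comp (eq_map (term_fv_ren s)) (map_comp (map s)) -map_flatten.
    by move=> /mapP.
  rewrite (_ : map_tuple _ _ = map_tuple (term_eval (e \o s)) ts)//.
  by apply/val_inj; rewrite /= -map_comp; apply: eq_map => t /=; rewrite term_eval_ren.
- by have [p' [fp hp]] := IH s; exists (FNot p'); split=> // e /=; rewrite hp.
- have [p' [fp hp]] := IHp s; have [q' [fq hq]] := IHq s.
  exists (FAnd p' q'); split=> [j|e] /=; last by rewrite hp hq.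
  by rewrite mem_cat => /orP[/fp|/fq] [i ip ->]; exists i; rewrite // mem_cat ip ?orbT.
(* [z] exceeds the image of every free variable of [p], so the new quantifier captures none of
   them. *)
- have [z hz] := seq_ub (map s (fv p)).
  have [p' [fp hp]] := IH [eta s with i |-> z].
  exists (FEx z p'); split=> [j|e] /=.
    rewrite mem_filter => /andP[jz /fp[k kp]] /=; case: eqVneq => [_ jz'|ki ->].
      by rewrite jz' eqxx in jz.
    by exists k; rewrite // mem_filter ki.
  suff E (a : M) : sat [eta e with z |-> a] p' <-> sat [eta e \o s with i |-> a] p.
    by split=> -[a] /E H; exists a.
  rewrite hp; apply: sat_fv => k kp /=; case: (eqVneq k i) => [|ki]; rewrite ?eqxx//.
  by case: eqVneq => // skz; have := hz _ (map_f s kp); rewrite skz ltnn.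
Qed.

(** [Some a] makes a variable read coordinate a, and [None] leaves it a parameter. This one
    operation drops, inserts and moves coordinates, and exchanges them with parameters. *)
Lemma D_subst L (M : structure L) n (phi : formula L) (t : nat -> option nat)
    (e : nat -> M) : (forall i a, t i = Some a -> a < n) ->
  D [set u : n.-tuple M | sat (fun i => oapp (nth (e i) u) (e i) (t i)) phi].
Proof.
move=> ht.
(* Storing the parameter [e i] in variable n + i keeps it clear of the n coordinates. *)
have [psi [_ hpsi]] := sat_ren M phi (fun i => odflt (n + i) (t i)).
exists psi, (fun j => e (j - n)); apply/predeqP => u; rewrite /defset /mkset hpsi.
suff -> : assign u (fun j => e (j - n)) \o (fun i => odflt (n + i) (t i)) =
  (fun i => oapp (nth (e i) u) (e i) (t i)) by [].
apply/funext => i; rewrite /assign /=; case: (t i) (ht i) => [a|] /= ha.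
  by apply: set_nth_default; rewrite size_tuple ha.
by rewrite nth_default ?size_tuple ?leq_addr// addKn.
Qed.

Definition mix T (P : pred nat) (y e : nat -> T) : nat -> T :=
  fun i => if P i then y i else e i.

Definition exs L (l : seq nat) (p : formula L) := foldr (@FEx L) p l.

Lemma sat_exs L (M : structure L) (e : nat -> M) l (p : formula L) :
  sat e (exs l p) <-> exists y, sat (mix (mem l) y e) p.
Proof.
elim: l e => [|i l IH] e /=.
  by split=> [h|[y]]; first by exists e.
split=> [[a /IH[y h]]|[y h]].
  (* If i recurs in [l], the inner quantifier decides its value. *)
  exists (fun j => if j \in l then y j else a); move: h; congr sat.
  apply/funext => j; rewrite /mix /= inE; case: (j \in l); rewrite ?orbT ?orbF//.
exists (y i); apply/IH; exists y; move: h; congr sat.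
apply/funext => j; rewrite /mix /= inE; case: eqVneq => [->|]//=.
by rewrite if_same.
Qed.

Lemma fv_exs L l (p : formula L) i : i \in fv (exs l p) -> (i \in fv p) && (i \notin l).
Proof.
by elim: l => [->|j l IH]//=; rewrite mem_filter inE negb_or => /andP[-> /IH].
Qed.

(** * Arithmetical formulas over definable relations *)

(* An abstraction of the two notions of saturation: "good" families of formulas
   are arbitrary families for saturated structures, and families computable in
   B for B-recursively saturated ones. *)
Record uniform L (M : structure L) (d : {X : set (1.-tuple M) | @D L M 1 X} -> M) :=
  Uniform {
  idx : Type;
  good : (idx -> formula L) -> Prop;
  good_cst : forall p, good (fun _ => p);
  good_not : forall p, good p -> good (fun w => FNot (p w));
  good_and : forall p q, good p -> good q -> good (fun w => FAnd (p w) (q w));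
  good_ex : forall i p, good p -> good (fun w => FEx i (p w));
  good_close : forall K p, good p -> exists q, [/\ good q,
    forall w i, i \in fv (q w) -> i < K &
    forall w (e : nat -> M), sat e (q w) <->
      exists2 e', (forall i, i < K -> e' i = e i) & sat e' (p w)];
  good_enum : exists2 g : nat -> idx -> formula L, forall i, good (g i) &
    forall r (t : nat -> formula L), exists w, forall i, i < r -> g i w = t i;
  good_abs : forall p, good p -> exists2 q, good q &
    forall w, unif_defines d (p w) (q w);
  good_compact : forall n K (e : nat -> M) p, good p ->
    (forall w i, i \in fv (p w) -> i < K) ->
    (forall x : n.-tuple M, exists w, sat (assign x e) (p w)) ->
    exists N (W : nat -> idx), forall x : n.-tuple M,
      exists2 i, i < N & sat (assign x e) (p (W i)) }.

Definition so_index (t : so_term) := match t with SVar i => i | SAbs j => j end.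

(** A strict bound on the indices and arity indices that occur. A relation quantifier contributes
    its arity even when its variable does not occur, so that every witness has its arity index below
    the bound. *)
Fixpoint so_size (phi : so_formula) : nat :=
  match phi with
  | SEq s t => maxn (so_index s).+1 (so_index t).+1
  | SEqR n i j => maxn n.+1 (maxn i.+1 j.+1)
  | SMem n j ts => maxn n.+1 (maxn j.+1 (\max_(t <- ts) (so_index t).+1))
  | SNot p => so_size p
  | SAnd p q => maxn (so_size p) (so_size q)
  | SEx i p => maxn i.+1 (so_size p)
  | SExR n j p | SAllR n j p => maxn n.+1 (so_size p)
  end.

Lemma set_rel_eq (N : so_structure) (E : forall n, nat -> rel_of N n) n j
    (P : rel_of N n) :
  set_rel E j P n j = P.
Proof. by rewrite /set_rel dfwith_in eqxx. Qed.

Lemma set_rel_neq (N : so_structure) (E : forall n, nat -> rel_of N n) n j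
    (P : rel_of N n) n' j' : (n', j') != (n, j) -> set_rel E j P n' j' = E n' j'.
Proof.
rewrite /set_rel; case: (eqVneq n' n) => [->|nn _].
  by rewrite dfwith_in xpair_eqE eqxx /= => /negPf ->.
by rewrite dfwith_out// eq_sym.
Qed.

Lemma assign_lt T n (x : n.-tuple T) (e e' : nat -> T) i :
  i < n -> assign x e i = assign x e' i.
Proof. by move=> lin; apply: set_nth_default; rewrite size_tuple. Qed.

Lemma assign_ge T n (x : n.-tuple T) (e : nat -> T) i : n <= i -> assign x e i = e i.
Proof. by move=> lin; apply: nth_default; rewrite size_tuple. Qed.

Lemma assign_mktuple T n (e' e : nat -> T) i :
  assign [tuple e' j | j < n] e i = if i < n then e' i else e i.
Proof.
case: ltnP => [lin|]; last exact: assign_ge.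
by rewrite /assign -[i]/(val (Ordinal lin)) -tnth_nth tnth_mktuple.
Qed.

Section Uniform.
Variables (L : language) (M : structure L).
Variable d : {X : set (1.-tuple M) | @D L M 1 X} -> M.
Variable U : uniform d.
Local Notation I := (idx U).
Local Notation N := (so_of d).
Implicit Types (S T : I -> (nat -> M) -> Prop) (p q r : I -> formula L).

(** * Predicates defined by good families of formulas *)

Definition udef S := exists2 p, good p & forall w e, S w e <-> sat e (p w).

Lemma udef_ext S T : (forall w e, S w e <-> T w e) -> udef S -> udef T.
Proof. by move=> h [p gp hp]; exists p => // w e; rewrite -h. Qed.

Lemma udef_sat p : good p -> udef (fun w e => sat e (p w)).
Proof. by move=> gp; exists p. Qed.

Lemma udef_not S : udef S -> udef (fun w e => ~ S w e).
Proof.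
move=> [p gp hp]; exists (fun w => FNot (p w)); first exact: good_not.
by move=> w e; rewrite hp.
Qed.

Lemma udef_and S T : udef S -> udef T -> udef (fun w e => S w e /\ T w e).
Proof.
move=> [p gp hp] [q gq hq]; exists (fun w => FAnd (p w) (q w)); first exact: good_and.
by move=> w e; rewrite hp hq.
Qed.

Lemma udef_eq i j : udef (fun w e => e i = e j).
Proof. by exists (fun=> FEq (TVar i) (TVar j)) => //; apply: good_cst. Qed.

Lemma udef_ex i S : udef S -> udef (fun w e => exists a, S w [eta e with i |-> a]).
Proof.
move=> [p gp hp]; exists (fun w => FEx i (p w)); first exact: good_ex.
by move=> w e; split=> -[a] /hp h; exists a.
Qed.

Lemma good_exs l p : good p -> good (fun w => exs l (p w)).
Proof. by move=> gp; elim: l => //= i l; apply: good_ex. Qed.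

Lemma udef_exs (l : seq nat) S :
  udef S -> udef (fun w e => exists y, S w (mix (mem l) y e)).
Proof.
move=> [p gp hp]; exists (fun w => exs l (p w)); first exact: good_exs.
by move=> w e; rewrite sat_exs; split=> -[y] /hp h; exists y.
Qed.

Lemma udef_all_lt n (S : nat -> I -> (nat -> M) -> Prop) :
  (forall i, i < n -> udef (S i)) -> udef (fun w e => forall i, i < n -> S i w e).
Proof.
elim: n => [|n IH] hS.
  by apply: udef_ext (udef_eq 0 0) => w e; split.
apply: udef_ext (udef_and (IH _) (hS n (leqnn _))) => [w e|i lin]; last first.
  by apply: hS; apply: ltnW.
split=> [[h hn] i|h]; last by split=> [i lin|]; apply: h => //; apply: ltnW.
by rewrite ltnS leq_eqVlt => /predU1P[->//|]; apply: h.
Qed.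

(** The relations defined do not depend on the values of v_n, ..., v_(K-1), which are therefore
    available for the variables of a translated formula and as scratch space. *)
Definition indep K n p := forall w (e e' : nat -> M), (forall i, K <= i -> e i = e' i) ->
  defset n (p w) e = defset n (p w) e'.

(* The scratch variables [s, s + n) hold the values of the variables t i while
   v_0, ..., v_(n-1) are overwritten, so that no substitution is needed. *)
Lemma udef_mem n p s K (t : nat -> nat) : good p -> indep K n p ->
  n <= s -> s + n <= K -> (forall i, i < n -> t i < s) ->
  udef (fun w e => defset n (p w) e [tuple e (t i) | i < n]).
Proof.
move=> gp ip ns snK ht.
have h1 : udef (fun w e => (forall i, i < n -> e i = e (s + i)) /\ sat e (p w)).
  by apply: udef_and (udef_sat gp); apply: udef_all_lt => i _; apply: udef_eq.
have h2 := udef_exs (iota 0 n) h1.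
have h3 : udef (fun w e => forall i, i < n -> e (s + i) = e (t i)).
  by apply: udef_all_lt => i _; apply: udef_eq.
apply: udef_ext (udef_exs (iota s n) (udef_and h3 h2)) => w e.
have key y y' : (forall i, i < n -> y' i = e (t i)) ->
  sat (mix (mem (iota 0 n)) y' (mix (mem (iota s n)) y e)) (p w) <->
  defset n (p w) e [tuple e (t i) | i < n].
  move=> hy'; set e' := mix _ y' _.
  rewrite (ip w e e') => [|i Ki]; last first.
    by rewrite /e' /mix /= !mem_iota !ifF//; lia.
  rewrite /defset /mkset; suff -> : assign [tuple e (t i) | i < n] e' = e' by [].
  apply/funext => i; rewrite (assign_mktuple n (fun j => e (t j))).
  by rewrite /e' /mix /= mem_iota add0n leq0n /=; case: ifPn => [/hy'|/negPf] ->.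
split.
- move=> [y [h [y' [h' hs]]]].
  have hy' i : i < n -> y' i = e (t i).
    move=> lin; have := h' i lin; have := h i lin; have := ht i lin.
    rewrite /mix /= !mem_iota lin /= !(leq_addr, ltn_add2l) lin /= => tis.
    rewrite add0n [s <= t i]leqNgt tis /= => -> ->.
    by rewrite ifF//; lia.
  exact: (key y y' hy').1 hs.
- move=> h; exists (fun i => e (t (i - s))); split=> [i lin|].
    have tis := ht i lin; rewrite /mix /= !mem_iota leq_addr ltn_add2l lin addKn.
    by rewrite ifF//; lia.
  exists (e \o t); split; last exact: (key _ (e \o t) (fun _ _ => erefl)).2 h.
  move=> i lin; rewrite /mix /= !mem_iota lin leq_addr ltn_add2l lin addKn /=.
  by rewrite ifF//; lia.
Qed.


Lemma udef_iff S T : udef S -> udef T -> udef (fun w e => S w e <-> T w e).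
Proof.
move=> hS hT; have h1 := udef_not (udef_and hS (udef_not hT)).
have h2 := udef_not (udef_and hT (udef_not hS)).
apply: udef_ext (udef_and h1 h2) => w e.
split=> [[nST nTS]|-[ST TS]]; last by split=> -[]; auto.
by split=> [s|t]; apply: contrapT => ?; [apply: nST|apply: nTS].
Qed.

Lemma udef_alls (l : seq nat) S :
  udef S -> udef (fun w e => forall y, S w (mix (mem l) y e)).
Proof.
move=> /udef_not/(udef_exs l)/udef_not; apply: udef_ext => w e.
by split=> [h y|h [y]]; [apply: contrapT => ?; apply: h; exists y|apply].
Qed.

(** * Translation of arithmetical formulas *)

Definition represents B (R : nat -> nat -> I -> formula L) w (e : nat -> M)
    (E : forall n, nat -> rel_of N n) :=
  forall n j, n < B -> j < B -> sval (E n j) = defset n.+1 (R n j w) e.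

(* The free variables of a translated second-order formula: v_0, ..., v_(B-1)
   are its object variables and v_B, ..., v_(2B-1) hold the values of the
   function symbol, while v_(2B), ..., v_(3B-1) serve as scratch space. *)
Definition so_pos B (t : so_term) : nat :=
  match t with SVar i => i | SAbs j => B + j end.

Lemma so_pos_lt B t : so_index t < B -> so_pos B t < 2 * B.
Proof. by case: t => i /=; lia. Qed.

Lemma so_index_nth B s k : \max_(t <- s) (so_index t).+1 <= B -> k < size s ->
  so_index (nth (SVar 0) s k) < B.
Proof.
elim: s k => // t s IH k; rewrite big_cons geq_max => /andP[tB sB].
by case: k => // k; apply: IH.
Qed.

Definition agrees B (e : nat -> N) (E : forall n, nat -> rel_of N n) (e' : nat -> M) :=
  (forall i, i < B -> e i = e' i) /\
  (forall j, j < B -> abstr (E 0 j) = e' (B + j) :> N).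

Lemma so_eval_agrees B e E e' t : agrees B e E e' -> so_index t < B ->
  so_eval e E t = e' (so_pos B t).
Proof. by move=> [h1 h2]; case: t => i /= iB; [apply: h1|apply: h2]. Qed.

Lemma mix_assign (e y : nat -> M) n :
  mix (mem (iota 0 n)) y e = assign [tuple y i | i < n] e.
Proof. by apply/funext => i; rewrite assign_mktuple /mix /= mem_iota. Qed.

(** An arithmetical formula never changes its relation variables, so the values of the abstraction
    operator on them stay fixed throughout. [agrees] stores them in variables once, and the
    induction treats the function symbol as a further object variable. *)
Lemma arith_udef_agrees B K R phi : arithmetical phi -> so_size phi <= B -> 3 * B <= K ->
  (forall n j, n < B -> j < B -> good (R n j) /\ indep K n.+1 (R n j)) ->
  exists2 S, udef S & forall w e e' E, represents B R w e' E -> agrees B e E e' ->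
    (S w e' <-> so_sat e E phi).
Proof.
move=> + + BK hR.
elim: phi => [s t|n i j|n j ts|p IH|p IHp q IHq|i p IH|//|//] /=.
- rewrite geq_max => _ /andP[sB tB].
  exists (fun w e => e (so_pos B s) = e (so_pos B t)); first exact: udef_eq.
  by move=> w e e' E _ fe; rewrite !(so_eval_agrees fe).
- rewrite !geq_max => _ /and3P[nB iB jB].
  have [[gi _] [gj _]] := (hR n i nB iB, hR n j nB jB).
  exists (fun w e => forall y, sat (mix (mem (iota 0 n.+1)) y e) (R n i w) <->
      sat (mix (mem (iota 0 n.+1)) y e) (R n j w)).
    apply: (@udef_alls _ (fun w e => sat e (R n i w) <-> sat e (R n j w))).
    by apply: udef_iff; apply: udef_sat.
  move=> w e e' E rE _; rewrite !rE//; split=> [h|E' y].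
    apply/predeqP => x; have := h (assign x e'); rewrite mix_assign /defset /mkset.
    suff -> : [tuple assign x e' i | i < n.+1] = x by [].
    by apply: eq_from_tnth => k; rewrite tnth_mktuple (tnth_nth (e' k)).
  have := congr1 (fun X => X [tuple y k | k < n.+1]) E'.
  by rewrite mix_assign /defset /mkset => ->.
- rewrite !geq_max => _ /and3P[nB jB tB].
  have [gj ij] := hR n j nB jB.
  have tlt k : k < n.+1 -> so_pos B (nth (SVar 0) ts k) < 2 * B.
    by move=> kn; apply/so_pos_lt/(so_index_nth tB); rewrite size_tuple.
  exists (fun (w : I) (e : nat -> M) => defset n.+1 (R n j w) e
      [tuple e (so_pos B (nth (SVar 0) ts k)) | k < n.+1]).
    by apply: (@udef_mem n.+1 (R n j) (2 * B) K
      (fun k => so_pos B (nth (SVar 0) ts k))) => //; lia.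
  move=> w e e' E rE fe; rewrite rE//.
  suff -> : map_tuple (@so_eval N e E) ts =
    [tuple e' (so_pos B (nth (SVar 0) ts k)) | k < n.+1] by [].
  apply: eq_from_tnth => k; rewrite tnth_map tnth_mktuple (tnth_nth (SVar 0)).
  by apply: so_eval_agrees fe _; apply: (so_index_nth tB); rewrite size_tuple.
- move=> ap pB; have [S uS hS] := IH ap pB.
  exists (fun w e => ~ S w e); first exact: udef_not.
  by move=> w e e' E rE fe; rewrite (hS w e e' E).
- rewrite geq_max => -[ap aq] /andP[pB qB].
  have [S uS hS] := IHp ap pB; have [T uT hT] := IHq aq qB.
  exists (fun w e => S w e /\ T w e); first exact: udef_and.
  by move=> w e e' E rE fe; rewrite (hS w e e' E)// (hT w e e' E).
- rewrite geq_max => ap /andP[iB pB]; have [S uS hS] := IH ap pB.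
  exists (fun w e => exists a, S w [eta e with i |-> a]); first exact: udef_ex.
  move=> w e e' E rE [fe ae].
  suff h a : S w [eta e' with i |-> a] <-> @so_sat N [eta e with i |-> a] E p.
    by split=> -[a] /h; exists a.
  apply: hS; last split.
  + move=> n j nB jB; rewrite rE//; apply: (hR n j nB jB).2 => k Kk /=.
    by case: eqP => // ki; lia.
  + by move=> k kB /=; case: eqP => // _; apply: fe.
  + by move=> j jB; rewrite ae//=; case: eqP => // ?; lia.
Qed.

(** [unif_defines] expects the value in v_0, so the value of v_k is copied there under a quantifier;
    k > 0 keeps v_k itself unaffected. *)
Lemma udef_abs q k : good q -> 0 < k -> udef (fun w e => e k = d (defcut 1 (q w) e)).
Proof.
move=> gq k0; have [q' gq' hq'] := good_abs gq.
apply: udef_ext (udef_ex 0 (udef_and (udef_eq 0 k) (udef_sat gq'))) => w e /=.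
split=> [[a]|ek].
  by rewrite gtn_eqF// => -[->] /hq' ->.
by exists (e k); rewrite gtn_eqF//; split=> //; apply/hq'.
Qed.

Lemma abstr_defcut (X : rel_of N 0) p w e : sval X = defset 1 (p w) e ->
  abstr X = d (defcut 1 (p w) e).
Proof. by case: X => X pX h; congr d; apply: eq_exist. Qed.

Lemma represents_indep B K R w e e' E :
  (forall n j, n < B -> j < B -> good (R n j) /\ indep K n.+1 (R n j)) ->
  (forall i, K <= i -> e i = e' i) -> represents B R w e E -> represents B R w e' E.
Proof. by move=> hR ee' rE n j nB jB; rewrite rE//; apply: (hR n j nB jB).2. Qed.

(** The stored values that [agrees] assumes are introduced by existential quantifiers over v_B, ...,
    v_(2B-1). Each is determined by its defining equation, so the quantifiers add no freedom. *)
Lemma arith_udef B K R phi : arithmetical phi -> so_size phi <= B -> 3 * B <= K ->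
  (forall n j, n < B -> j < B -> good (R n j) /\ indep K n.+1 (R n j)) ->
  exists2 S, udef S & forall w e e' E, represents B R w e' E ->
    (forall i, i < B -> e i = e' i) -> (S w e' <-> @so_sat N e E phi).
Proof.
move=> ap pB BK hR; have [S uS hS] := arith_udef_agrees ap pB BK hR.
have uA : udef (fun w e => forall j, j < B -> e (B + j) = d (defcut 1 (R 0 j w) e)).
  apply: udef_all_lt => j jB; apply: udef_abs; last by lia.
  by apply: (hR _ _ _ jB).1; lia.
exists (fun w e => exists y,
  (fun w e => (forall j, j < B -> e (B + j) = d (defcut 1 (R 0 j w) e)) /\ S w e)
  w (mix (mem (iota B B)) y e)); first exact: (udef_exs (iota B B) (udef_and uA uS)).
move=> w e e' E rE ee'.
have rE' y : represents B R w (mix (mem (iota B B)) y e') E.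
  apply: represents_indep hR _ rE => i Ki.
  by rewrite /mix /= mem_iota ifF//; lia.
have ee'' y i : i < B -> e i = mix (mem (iota B B)) y e' i.
  by move=> iB; rewrite ee'// /mix /= mem_iota ifF//; lia.
split=> [[y [hy]]|he].
  apply: (hS _ _ _ _ (rE' y) _).1; split=> [|j jB]; first exact: ee''.
  by rewrite hy//; apply: abstr_defcut; apply: rE'; lia.
pose y i : M := abstr (E 0 (i - B)).
have hy j : j < B -> mix (mem (iota B B)) y e' (B + j) = abstr (E 0 j) :> N.
  by move=> jB; rewrite /mix /= mem_iota ifT ?/y ?addKn//; lia.
exists y; split=> [j jB|].
  by rewrite hy//; apply: abstr_defcut; apply: rE'; lia.
have fy : agrees B e E (mix (mem (iota B B)) y e').
  by split=> [|j jB]; [exact: ee''|rewrite hy].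
exact: (hS _ _ _ _ (rE' y) fy).2 he.
Qed.

(** * Normal form of Sigma^1_1 formulas *)

Definition update_rel (R : nat -> nat -> I -> formula L) n j p n' j' :=
  if (n', j') == (n, j) then p else R n' j'.

Lemma represents_set B R n j p w e (E : forall n, nat -> rel_of N n) (P : rel_of N n) :
  represents B R w e E -> sval P = defset n.+1 (p w) e ->
  represents B (update_rel R n j p) w e (set_rel E j P).
Proof.
move=> rE hP n' j' n'B j'B; rewrite /update_rel; case: (eqVneq (n', j') (n, j)).
  by case=> -> ->; rewrite set_rel_eq.
by move=> h; rewrite set_rel_neq// rE.
Qed.

(* Q i is the i-th quantified relation, the arity of which is known only once the
   prefix of the formula is. *)
Definition defines_witness (rho : nat -> nat -> I -> formula L) w e
    (Q : nat -> {n & rel_of N n}) i :=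
  sval (projT2 (Q i)) = defset (projT1 (Q i)).+1 (rho i (projT1 (Q i)) w) e.

(** One [w] and one assignment must define all witnesses at once. So completeness first yields the
    relations [Q i], and only then quantifies over the [w] and [e'] that define them. Soundness
    needs no such choice: whatever [rho] defines is a legitimate witness. *)
Lemma sigma_udef B K R (rho : nat -> nat -> I -> formula L) phi i0 :
  Sigma11 phi -> so_size phi <= B -> 3 * B <= K ->
  (forall n j, n < B -> j < B -> good (R n j) /\ indep K n.+1 (R n j)) ->
  (forall i n, good (rho i n) /\ indep K n.+1 (rho i n)) ->
  exists S m, [/\ udef S,
    forall w e e' E, represents B R w e' E -> (forall i, i < B -> e i = e' i) ->
      S w e' -> @so_sat N e E phi &
    forall e E, @so_sat N e E phi ->
      exists2 Q : nat -> {n & rel_of N n}, (forall i, projT1 (Q i) < B) &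
        forall w e', represents B R w e' E ->
        (forall i, i < B -> e i = e' i) ->
        (forall i, i0 <= i < m -> defines_witness rho w e' Q i) -> S w e'].
Proof.
move=> sp; elim: sp R i0 => {phi} [phi ap|n j phi sp IH] R i0 pB BK hR hrho.
  have [S uS hS] := arith_udef ap pB BK hR.
  exists S, i0; split=> // [w e e' E rE ee'|e E se].
    by move/(hS _ _ _ _ rE ee').
  (* Beyond the prefix [Q] is a dummy of arity index 0, which must still lie below B. *)
  have B0 : 0 < B by apply: leq_trans pB; elim: (phi) => //= *; lia.
  exists (fun=> existT _ 0 (E 0 0)) => // w e' rE ee' _.
  exact/(hS _ _ _ _ rE ee').
move: pB; rewrite /= geq_max => /andP[nB pB].
have [n' j' n'B j'B|S [m [uS sS cS]]] :=
    IH (update_rel R n j (rho i0 n)) i0.+1 pB BK _ hrho.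
  by rewrite /update_rel; case: eqP => [[-> _]|_]; [exact: hrho|exact: hR].
(* The induction hypothesis does not tell that m exceeds i0; the maximum puts the outermost witness
   in the range. *)
exists S, (maxn m i0.+1); split=> // [w e e' E rE ee' /sS h|e E [P /cS[Q QB hQ]]].
  exists (defcut n.+1 (rho i0 n w) e'); apply: h => //.
  exact: represents_set.
exists (fun i => if i == i0 then existT _ n P else Q i) => [i|w e' rE ee' h].
  by case: eqP.
apply: hQ => // [|i hi].
  apply: represents_set => //; have := h i0; rewrite /defines_witness eqxx; apply.
  by rewrite leqnn leq_max ltnSn orbT.
have := h i; rewrite /defines_witness gtn_eqF; last by case/andP: hi.
by apply; case/andP: hi => /ltnW -> ?; rewrite leq_max; apply/orP; left.
Qed.

(** Each relation comes with its own formula and assignment. Moving the parameters to consecutive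
    blocks from K on lets a single assignment serve all of them, and K exceeds the arity indices, so
    no coordinate is overwritten. *)
Lemma params_merge m (Q : nat -> {n & rel_of N n}) K (e0 : nat -> M) :
  (forall i, i < m -> projT1 (Q i) < K) ->
  exists K' e (th : nat -> formula L), [/\ K <= K', forall i, i < K -> e i = e0 i,
    forall i, i < m -> sval (projT2 (Q i)) = defset (projT1 (Q i)).+1 (th i) e &
    forall i, i < m -> forall j, j \in fv (th i) ->
      (j <= projT1 (Q i)) || (K <= j < K')].
Proof.
elim: m => [_|m IH hQ]; first by exists K, e0, (fun=> FEq (TVar 0) (TVar 0)).
have [|K' [e [th [KK' ee0 hth fth]]]] := IH; first by move=> i /ltnW; apply: hQ.
case EQ: (Q m) (hQ m (leqnn _)) => [n [X [phi [e1 DX]]]] /= nK.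
(* Coordinates stay in place; parameters go to a block above all those used so far. *)
have [psi [fpsi hpsi]] := sat_ren M phi (fun j => if j <= n then j else K' + j).
have [K1 hK1] := seq_ub (fv phi).
exists (K' + K1), (fun j => if j < K' then e j else e1 (j - K')),
  (fun i => if i == m then psi else th i); split=> [|i iK|i|i].
- by lia.
- by rewrite ifT ?ee0//; lia.
- rewrite ltnS leq_eqVlt => /predU1P[->|im]; rewrite ?eqxx.
    rewrite EQ /= DX; apply/predeqP => x; rewrite /defset /mkset hpsi.
    apply: sat_fv => j _ /=; case: (leqP j n) => jn; first exact: assign_lt.
    by rewrite !assign_ge ?ifF ?addKn//; lia.
  rewrite (ltn_eqF im) hth//; apply/predeqP => x; rewrite /defset /mkset.
  apply: sat_fv => j /(fth _ im); case: (leqP j (projT1 (Q i))) => ji /= h.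
    exact: assign_lt.
  by rewrite !assign_ge ?ifT//; lia.
- rewrite ltnS leq_eqVlt => /predU1P[->|im] j; rewrite ?eqxx.
    rewrite EQ /= => /fpsi[k /hK1 kK1 ->]; case: ifP => // kn; lia.
  by rewrite (ltn_eqF im) => /(fth _ im); lia.
Qed.

(* The parameters of the free relation variables are stored in v_i for
   K0 <= i < K1; those of the quantified ones, which depend on the index w, in
   v_i for i >= K1. *)
Lemma setup B K0 (eb : nat -> M) (E : forall n, nat -> rel_of N n) : B <= K0 ->
  exists K1 e0 (R rho : nat -> nat -> I -> formula L),
  [/\ K0 <= K1 /\ (forall i, i < K0 -> e0 i = eb i),
    forall n j, n < B -> j < B -> good (R n j) /\ indep K0 n.+1 (R n j),
    forall i n, good (rho i n) /\ indep K1 n.+1 (rho i n),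
    forall w e, (forall i, K0 <= i < K1 -> e i = e0 i) -> represents B R w e E &
    forall m Q, (forall i, projT1 (Q i) < B) -> exists w e,
      (forall i, i < K1 -> e i = e0 i) /\ forall i, i < m -> defines_witness rho w e Q i].
Proof.
move=> BK0.
pose Q0 i : {n & rel_of N n} := existT _ (i %/ B) (E (i %/ B) (i %% B)).
have [|K1 [e0 [th [K01 e0b hth fth]]]] := @params_merge (B * B) Q0 K0 eb.
  move=> i iB /=; apply: leq_trans BK0; rewrite ltn_divLR//.
  by case: (B) iB.
have [g gg hg] := good_enum U.
(* [g i w] may be any formula. The quantifiers force independence of the variables below [K1], and
   are vacuous on the formulas delivered by [params_merge]. *)
pose rho i n w := exs (iota n.+1 (K1 - n.+1)) (g i w).
have idx n j : n < B -> j < B ->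
    [/\ n * B + j < B * B, (n * B + j) %/ B = n & (n * B + j) %% B = j].
  move=> nB jB; rewrite divnMDl ?divn_small ?addn0 ?modnMDl ?modn_small//; last lia.
  by split=> //; nia.
exists K1, e0, (fun n j _ => th (n * B + j)), rho; split.
- by [].
- move=> n j nB jB; have [lt dv md] := idx n j nB jB; split; first exact: good_cst.
  move=> w e e' ee'; apply/predeqP => x; apply: sat_fv => k /(fth _ lt).
  rewrite /= dv; case: (leqP k n) => /= kn h; first exact: assign_lt.
  by rewrite !assign_ge// ee'//; case/andP: h.
- move=> i n; split; first exact: good_exs.
  move=> w e e' ee'; apply/predeqP => x; rewrite /defset /mkset !sat_exs.
  suff h y : mix (mem (iota n.+1 (K1 - n.+1))) y (assign x e) =
      mix (mem (iota n.+1 (K1 - n.+1))) y (assign x e').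
    by split=> -[y hy]; exists y; rewrite ?h// -h.
  apply/funext => k; rewrite /mix /= mem_iota; case: ifP => // kn.
  have [kn'|nk] := ltnP k n.+1; first exact: assign_lt.
  by rewrite !assign_ge// ee'//; lia.
- move=> w e ee0 n j nB jB; have [lt dv md] := idx n j nB jB.
  have := hth _ lt; rewrite /= dv md => ->; apply/predeqP => x; apply: sat_fv.
  move=> k /(fth _ lt); rewrite /= dv.
  case: (leqP k n) => /= kn h; first exact: assign_lt.
  by rewrite !assign_ge// ee0.
- move=> m Q hQ; have [|K2 [e [th' [K12 ee0 hth' fth']]]] := @params_merge m Q K1 e0.
    by move=> i _; apply: leq_trans (hQ i) _; lia.
  have [w hw] := hg m th'; exists w, e; split=> // i im.
  rewrite /defines_witness hth'// /rho hw//; apply/predeqP => x.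
  rewrite /defset /mkset sat_exs.
  split=> [h|[y]].
    exists (assign x e); move: h; congr sat; apply/funext => k.
    by rewrite /mix; case: ifP.
  apply: (sat_fv _).2 => k /(fth' _ im) h; rewrite /mix /= mem_iota.
  by rewrite ifF//; lia.
Qed.

Lemma indep_le K K' n p : K <= K' -> indep K' n p -> indep K n p.
Proof. by move=> KK' ip w e e' ee'; apply: ip => i /(leq_trans KK'); apply: ee'. Qed.

(** The new parameters are placed from [K0] on and any [e'] extending [e0] below [K1] is allowed. A
    second application can thus start from the result of the first, and both families are evaluated
    under one assignment. *)
Lemma sigma_nf B K0 (eb : nat -> M) phi k (e : nat -> N) E :
  Sigma11 phi -> so_size phi <= B -> k < B -> 3 * B <= K0 ->
  (forall i, i < B -> eb i = e i) ->
  exists K1 e0 p, [/\ K0 <= K1 /\ (forall i, i < K0 -> e0 i = eb i), good p,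
    forall w i, i \in fv (p w) -> i < K1 &
    forall (x : k.+1.-tuple N) e', (forall i, i < K1 -> e' i = e0 i) ->
      @so_sat N (assign x e) E phi <->
      exists w, sat (assign (x : k.+1.-tuple M) e') (p w)].
Proof.
move=> sp pB kB BK0 ebe.
have [|K1 [e0 [R [rho [[K01 e0b] hR hrho rE hits]]]]] := @setup B K0 eb E.
  by lia.
have [|S [m [[p gp hS] sS cS]]] := @sigma_udef B K0 R rho phi 0 sp pB BK0 hR.
  by move=> i n; split; [apply: (hrho i n).1|apply: indep_le (hrho i n).2].
(* The parameters of the witnesses, whose number depends on [w], are quantified away; this bounds
   the free variables uniformly, as compactness requires. *)
have [q [gq fq hq]] := good_close K1 gp.
exists K1, e0, q; split=> // x e' e'0.
have rE' w e'' : (forall i, i < K1 -> e'' i = assign (x : k.+1.-tuple M) e' i) ->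
    represents B R w e'' E /\ forall i, i < B -> assign x e i = e'' i.
  move=> h; split=> [|i iB].
    apply: rE => i /andP[Ki iK]; rewrite h// assign_ge ?e'0//.
    by apply: leq_trans Ki; lia.
  rewrite h; last by lia.
  have [ik|ki] := ltnP i k.+1; first exact: assign_lt.
  by rewrite !assign_ge// e'0 ?e0b ?ebe//; lia.
split=> [/cS[Q QB hQ]|[w /hq[e'' /(rE' w)[rw ew] /hS h]]]; last exact: sS rw ew h.
have [w [e'' [e''0 hw]]] := hits m Q QB.
exists w; apply/hq; exists (assign (x : k.+1.-tuple M) e'') => [i iK|].
  have [ik|ki] := ltnP i k.+1; first exact: assign_lt.
  by rewrite !assign_ge// e''0 ?e'0.
apply/hS; have [|rw ew] := rE' w (assign (x : k.+1.-tuple M) e'').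
  move=> i iK; have [ik|ki] := ltnP i k.+1; first exact: assign_lt.
  by rewrite !assign_ge// e''0 ?e'0.
apply: hQ => // i /hw; rewrite /defines_witness => ->.
apply: (hrho _ _).2 => j Kj; rewrite assign_ge//; lia.
Qed.

(** * Comprehension for Delta^1_1 formulas *)

Lemma pi_neg phi : Pi11 phi -> exists2 psi, Sigma11 psi &
  forall e E, @so_sat N e E psi <-> ~ @so_sat N e E phi.
Proof.
elim=> [{}phi ap|n j {}phi _ [psi sp hp]].
  by exists (SNot phi) => //; apply: Sigma11_arith.
exists (SExR n j psi) => [|e E /=]; first exact: Sigma11_ex.
split=> [[P /hp hP] h|h]; first exact/hP/h.
apply: contrapT => h'; apply: h => P; apply: contrapT => hP.
by apply: h'; exists P; apply/hp.
Qed.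

Lemma good_or p q : good p -> good q ->
  good (fun w => FNot (FAnd (FNot (p w)) (FNot (q w)))).
Proof.
by move=> gp gq; apply: good_not; apply: good_and; apply: good_not.
Qed.

Lemma sat_or (e : nat -> M) (a b : formula L) :
  sat e (FNot (FAnd (FNot a) (FNot b))) <-> sat e a \/ sat e b.
Proof.
split=> /= [h|[?|?] []//].
by apply: contrapT => /not_orP [na nb]; apply: h.
Qed.

Lemma Delta11_comprehension_uniform : Delta11_comprehension N.
Proof.
move=> phi psi sphi /pi_neg[psi' spsi' hpsi'] e E k hphi.
pose B := maxn k.+1 (maxn (so_size phi) (so_size psi')).
have hB : [/\ so_size phi <= B, so_size psi' <= B & k < B].
  by rewrite /B; split; lia.
have [pB pB' kB] := hB.
have [K1 [e1 [p1 [[BK1 e1e] gp1 fp1 hp1]]]] :=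
  sigma_nf E sphi pB kB (leqnn _) (fun i _ => erefl (e i)).
have [|K2 [e2 [p2 [[K12 e2e] gp2 fp2 hp2]]]] :=
  @sigma_nf B K1 e1 psi' k e E spsi' pB' kB BK1.
  by move=> i iB; rewrite e1e//; lia.
have [||m [W hW]] := good_compact (n := k.+1) (K := K2) (e := e2) (good_or gp1 gp2).
- move=> w i /=; rewrite mem_cat => /orP[/fp1|/fp2]; lia.
- move=> x; have [h|h] := EM (@so_sat N (assign x e) E phi).
    by have /hp1 -/(_ _ e2e)[w hw] := h; exists w; apply/sat_or; left.
  have /hp2 -/(_ e2)[//|w hw] : @so_sat N (assign x e) E psi'.
    by apply/hpsi'; rewrite -hphi.
  by exists w; apply/sat_or; right.
(* Only [p1] enters the disjunction: a point of [phi] covered through [p2] would satisfy the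
   negation of [psi]. *)
pose th := foldr (fun i f => FNot (FAnd (FNot (p1 (W i))) (FNot f)))
  (FNot (FEq (TVar 0) (TVar 0))) (iota 0 m).
have hth e' : sat e' th <-> exists2 i, i < m & sat (e' : nat -> M) (p1 (W i)).
  rewrite (_ : (exists2 i, _ & _) <-> exists2 i, i \in iota 0 m & sat e' (p1 (W i))).
    rewrite /th; elim: (iota 0 m) => [|i s IH]; first by split=> /= [|[]].
    rewrite [foldr _ _ _]/= sat_or; split=> [[h|/IH[j js h]]|[j]].
    - by exists i; rewrite ?inE ?eqxx.
    - by exists j; rewrite ?inE ?js ?orbT.
    - by rewrite inE => /predU1P[-> h|js h]; [left|right; apply/IH; exists j].
  by split=> -[i im h]; exists i; rewrite // mem_iota in im *.
exists (defcut k.+1 th e2) => x; rewrite /= /defset /mkset hth; split=> [[i im h]|h].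
  by apply/hp1; [exact: e2e|exists (W i)].
have [i im /sat_or[hi|hi]] := hW x; first by exists i.
have : @so_sat N (assign x e) E psi' by apply/hp2; [|exists (W i)].
by move/hpsi'; rewrite -hphi.
Qed.
End Uniform.

(** * Skolem functions and choice *)

Section Arithmetical.
Variable N : so_structure.
Implicit Types S T : (nat -> N) -> (forall n, nat -> rel_of N n) -> Prop.

(** Lets the instances of choice and comprehension below be given as predicates, with their formulas
    built by closure lemmas. *)
Definition adef S := exists2 phi, arithmetical phi & forall e E, S e E <-> so_sat e E phi.

Lemma adef_ext S T : (forall e E, S e E <-> T e E) -> adef S -> adef T.
Proof. by move=> h [p ap hp]; exists p => // e E; rewrite -h. Qed.

Lemma adef_not S : adef S -> adef (fun e E => ~ S e E).
Proof. by move=> [p ap hp]; exists (SNot p) => // e E; rewrite hp. Qed.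

Lemma adef_and S T : adef S -> adef T -> adef (fun e E => S e E /\ T e E).
Proof.
by move=> [p ap hp] [q aq hq]; exists (SAnd p q) => // e E; rewrite hp hq.
Qed.

Lemma adef_or S T : adef S -> adef T -> adef (fun e E => S e E \/ T e E).
Proof.
move=> hS hT; apply: adef_ext (adef_not (adef_and (adef_not hS) (adef_not hT))).
move=> e E; split=> [h|[?|?] []//].
by apply: contrapT => /not_orP[? ?]; apply: h.
Qed.

Lemma adef_imp S T : adef S -> adef T -> adef (fun e E => S e E -> T e E).
Proof.
move=> hS hT; apply: adef_ext (adef_not (adef_and hS (adef_not hT))) => e E.
by split=> [h s|h [/h]//]; apply: contrapT => ?; apply: h.
Qed.

Lemma adef_eq i j : adef (fun e _ => e i = e j).
Proof. by exists (SEq (SVar i) (SVar j)). Qed.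

Lemma adef_ex i S : adef S -> adef (fun e E => exists a, S [eta e with i |-> a] E).
Proof.
move=> [p ap hp]; exists (SEx i p) => // e E /=.
by split=> -[a] /hp h; exists a.
Qed.

Lemma adef_exs (l : seq nat) S :
  adef S -> adef (fun e E => exists y, S (mix (mem l) y e) E).
Proof.
elim: l S => [|i l IH] S hS.
  by apply: adef_ext hS => e E; split=> [h|[y]]; first by exists e.
apply: adef_ext (adef_ex i (IH _ hS)) => e E; split=> [[a [y h]]|[y h]].
  exists (fun j => if j \in l then y j else a); move: h.
  congr (S _ E); apply/funext => j; rewrite /mix /= inE.
  by case: (j \in l); rewrite ?orbT ?orbF.
exists (y i), y; move: h; congr (S _ E).
apply/funext => j; rewrite /mix /= inE; case: eqVneq => [->|]//=.
by rewrite if_same.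
Qed.

Lemma adef_alls (l : seq nat) S :
  adef S -> adef (fun e E => forall y, S (mix (mem l) y e) E).
Proof.
move=> /adef_not/(adef_exs l)/adef_not; apply: adef_ext => e E.
by split=> [h y|h [y]]; [apply: contrapT => ?; apply: h; exists y|apply].
Qed.

Lemma adef_all_lt n (S : nat -> (nat -> N) -> (forall n, nat -> rel_of N n) -> Prop) :
  (forall i, i < n -> adef (S i)) -> adef (fun e E => forall i, i < n -> S i e E).
Proof.
elim: n => [|n IH] hS.
  by apply: adef_ext (adef_eq 0 0) => e E; split.
apply: adef_ext (adef_and (IH _) (hS n (leqnn _))) => [e E|i lin]; last first.
  by apply: hS; apply: ltnW.
split=> [[h hn] i|h]; last by split=> [i lin|]; apply: h => //; apply: ltnW.
by rewrite ltnS leq_eqVlt => /predU1P[->//|]; apply: h.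
Qed.

Lemma adef_mem n j (t : nat -> nat) :
  adef (fun e E => sval (E n j) [tuple e (t i) | i < n.+1]).
Proof.
exists (SMem j [tuple SVar (t i) | i < n.+1]) => // e E /=.
suff -> : map_tuple (so_eval e E) [tuple SVar (t i) | i < n.+1] =
  [tuple e (t i) | i < n.+1] by [].
by apply: eq_from_tnth => i; rewrite tnth_map !tnth_mktuple.
Qed.

End Arithmetical.

Lemma eq_tuple_nth T n (x0 : T) (x y : n.-tuple T) :
  (forall i, i < n -> nth x0 x i = nth x0 y i) -> x = y.
Proof. by move=> h; apply: eq_from_tnth => i; rewrite !(tnth_nth x0) h. Qed.

Lemma nth_mktuple_lt T n (x0 : T) (f : nat -> T) i :
  i < n -> nth x0 [tuple f j | j < n] i = f i.
Proof.
move=> lin; rewrite -[i]/(val (Ordinal lin)) -tnth_nth tnth_mktuple //.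
Qed.

Lemma mix_in T (l : seq nat) (y e : nat -> T) i : i \in l -> mix (mem l) y e i = y i.
Proof. by rewrite /mix /= => ->. Qed.

Lemma mix_out T (l : seq nat) (y e : nat -> T) i :
  i \notin l -> mix (mem l) y e i = e i.
Proof. by rewrite /mix /= => /negPf ->. Qed.

(** * Skolem functions from choice *)

Section Skolem.
Variables (L : language) (M : structure L).
Variable d : {X : set (1.-tuple M) | @D L M 1 X} -> M.
Local Notation N := (so_of d).

(** Choice speaks of relations of the structure that coincide with a fibre of R, so the fibre has to
    be shown definable. *)
Lemma D_section k n (R : set ((k + n).-tuple M)) (x : k.-tuple M) : D R ->
  D [set y : n.-tuple M | R (cat_tuple x y)].
Proof.
move=> [th [e ->]].
(* The coordinates of x become parameters and those of y move down by k. *)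
pose t i := if k <= i < k + n then Some (i - k) else None.
have ht i a : t i = Some a -> a < n by rewrite /t; case: ifP => // ? [<-]; lia.
have := D_subst th (assign x e) ht; congr D; apply/predeqP => y; apply: sat_fv.
move=> i _; rewrite /t /assign nth_cat size_tuple; have [ik|ki] := ltnP i k => //=.
have [ikn|kni] := ltnP i (k + n) => /=.
  by apply: set_nth_default; rewrite size_tuple; lia.
by rewrite !nth_default// size_tuple; lia.
Qed.

Lemma D_set1 n (y : n.-tuple M) : D [set y].
Proof.
have [c] := carrier_inh M.
pose th := foldr (fun i f => FAnd (FEq (TVar i) (TVar (n + i))) f)
  (FEq (TVar 0) (TVar 0)) (iota 0 n) : formula L.
have hth e : sat (e : nat -> M) th <-> forall i, i \in iota 0 n -> e i = e (n + i).
  rewrite /th; elim: (iota 0 n) => [|i s IH] //=; rewrite IH.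
  split=> [[h hs] j|h]; first by rewrite inE => /predU1P[->//|]; apply: hs.
  by split=> [|j js]; apply: h; rewrite inE ?eqxx ?js ?orbT.
exists th, (fun i => nth c y (i - n)); apply/predeqP => x; rewrite /defset /mkset hth.
have E i : i < n -> (assign x (fun i => nth c y (i - n)) i = nth c x i) /\
    (assign x (fun i => nth c y (i - n)) (n + i) = nth c y i).
  move=> lin; rewrite (@assign_ge _ _ _ _ (n + i)) ?leq_addr// addKn; split=> //.
  by apply: set_nth_default; rewrite size_tuple.
split=> [/= xy i|h].
  by rewrite mem_iota add0n => /= lin; have [-> ->] := E i lin; rewrite xy.
apply: (eq_tuple_nth (x0 := c)) => i lin; have [<- <-] := E i lin.
by apply: h; rewrite mem_iota.
Qed.

(* The variable v_m is a dummy, which makes the arity of x positive. *)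
Lemma skolem_of_choice : Sigma11_choice N -> definable_skolem M.
Proof.
move=> hN m [|n] P DP.
  (* The empty tuple is the only candidate, so P is its own Skolem function; the case is separate
     because relations of the structure have positive arity. *)
  exists P; split=> // x [y Py]; exists y; split=> // y' _.
  by rewrite (tuple0 y) (tuple0 y').
have [c] := carrier_inh M.
have [th [e0 EP]] := DP.
pose t i := if i < m then Some i else if i < m + n.+1 then Some i.+1 else None.
have ht i a : t i = Some a -> a < m.+1 + n.+1.
  by rewrite /t; case: ifP => [? [<-]|_]; [lia|case: ifP => // ? [<-]; lia].
pose Pd : rel_of N (m + n.+1) := exist _ _ (D_subst th e0 ht).
have PdE (x : m.-tuple M) (y : n.+1.-tuple M) a :
    sval Pd (cat_tuple (rcons_tuple x a) y) <-> P (cat_tuple x y).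
  rewrite EP; apply: sat_fv => i _.
  rewrite /t /assign /= nth_cat size_tuple; case: (ltnP i m) => im /=.
    by rewrite nth_cat size_rcons size_tuple ltnS ltnW// nth_rcons size_tuple im.
  case: ltnP => imn /=.
    rewrite nth_cat size_rcons size_tuple ltnS ltnNge im /= subSS.
    by apply: set_nth_default; rewrite size_tuple; lia.
  by rewrite nth_default// size_tuple; lia.
(* The block at [a] holds a tuple y of the fibre, the block at [b] a second tuple, compared with y
   for uniqueness. *)
pose a := m.+1; pose b := a + n.+1.
(* P is relation variable number 1, as [Sigma11_choice] reserves number 0 for the chosen
   relation. *)
pose A (e : nat -> N) (E : forall n, nat -> rel_of N n) :=
  sval (E (m + n.+1) 1) [tuple e i | i < (m + n.+1).+1].
pose Q (e : nat -> N) (E : forall n, nat -> rel_of N n) :=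
  sval (E n 0) [tuple e (a + i) | i < n.+1].
pose Q' (e : nat -> N) (E : forall n, nat -> rel_of N n) :=
  sval (E n 0) [tuple e (b + i) | i < n.+1].
have aA : adef A by apply: (@adef_mem N (m + n.+1) 1 id).
have aQ : adef Q by apply: (@adef_mem N n 0 (fun i => a + i)).
have aQ' : adef Q' by apply: (@adef_mem N n 0 (fun i => b + i)).
pose eqab (e : nat -> N) (_ : forall n, nat -> rel_of N n) :=
  forall i, i < n.+1 -> e (b + i) = e (a + i).
have aeq : adef eqab by apply: adef_all_lt => i _; apply: adef_eq.
pose la := iota a n.+1; pose lb := iota b n.+1.
have := adef_and (adef_alls la (adef_imp aQ aA)) (adef_imp (adef_exs la aA)
  (adef_exs la (adef_and aQ (adef_alls lb (adef_imp aQ' aeq))))).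
move=> [phi aphi hphi].
pose E0 n (j : nat) : rel_of N n := defcut n.+1 (FEq (TVar 0) (TVar 0)) (fun=> c).
pose E1 : forall n, nat -> rel_of N n := set_rel E0 1 Pd.
have sem (x : m.+1.-tuple N) (F : rel_of N n) :
    so_sat (assign x (fun=> c)) (set_rel E1 0 F) phi <->
    (forall y, sval F y -> sval Pd (cat_tuple x y)) /\
    ((exists y, sval Pd (cat_tuple x y)) ->
      exists y, sval F y /\ forall z, sval F z -> z = y).
  rewrite -hphi; set e := assign x _; set E := set_rel E1 0 F.
  have EP1 : E (m + n.+1) 1 = Pd.
    by rewrite /E set_rel_neq ?xpair_eqE ?andbF// /E1 set_rel_eq.
  have EF : E n 0 = F by rewrite /E set_rel_eq.
  pose T s (y : nat -> N) := [tuple y (s + i) | i < n.+1].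
  have TK s (v : n.+1.-tuple N) : T s (fun i => nth c v (i - s)) = v.
    apply: (eq_tuple_nth (x0 := c)) => i lin.
    by rewrite (nth_mktuple_lt _ (fun j => nth c v (s + j - s)))// addKn.
  have hA y : A (mix (mem la) y e) E <-> sval Pd (cat_tuple x (T a y)).
    rewrite /A EP1; suff -> : [tuple mix (mem la) y e i | i < (m + n.+1).+1] =
      cat_tuple x (T a y) by [].
    apply: (eq_tuple_nth (x0 := c)) => i lin; rewrite nth_mktuple_lt// nth_cat size_tuple.
    case: ltnP => im; first by rewrite mix_out// mem_iota; lia.
    rewrite mix_in ?mem_iota; last by lia.
    by rewrite (nth_mktuple_lt _ (fun j => y (a + j))) ?subnKC//; lia.
  have hQ y : Q (mix (mem la) y e) E <-> sval F (T a y).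
    rewrite /Q EF; suff -> : [tuple mix (mem la) y e (a + i) | i < n.+1] = T a y by [].
    by apply: eq_mktuple => i; rewrite mix_in// mem_iota; have := ltn_ord i; lia.
  have hQ' z e' : Q' (mix (mem lb) z e') E <-> sval F (T b z).
    rewrite /Q' EF.
    suff -> : [tuple mix (mem lb) z e' (b + i) | i < n.+1] = T b z by [].
    by apply: eq_mktuple => i; rewrite mix_in// mem_iota; have := ltn_ord i; lia.
  have heq z y : eqab (mix (mem lb) z (mix (mem la) y e)) E <-> T b z = T a y.
    have h i : i < n.+1 -> mix (mem lb) z (mix (mem la) y e) (b + i) = z (b + i) /\
        mix (mem lb) z (mix (mem la) y e) (a + i) = y (a + i).
      move=> lin; have h1 : b + i \in lb by rewrite mem_iota; lia.
      have h2 : a + i \notin lb by rewrite mem_iota /b; lia.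
      have h3 : a + i \in la by rewrite mem_iota; lia.
      by rewrite (mix_in _ _ h1) (mix_out _ _ h2) (mix_in _ _ h3).
    split=> [hz|hz i lin].
      by apply: eq_mktuple => i; have [<- <-] := h i (ltn_ord i); apply: hz.
    have [-> ->] := h i lin; have := congr1 (fun v => nth c (val v) i) hz.
    by rewrite (nth_mktuple_lt _ (fun j => z (b + j)))//
               (nth_mktuple_lt _ (fun j => y (a + j))).
  split=> [[h1 h2]|[h1 h2]].
  - split=> [y Fy|[y Py]].
      by rewrite -(TK a y); apply/hA/h1/hQ; rewrite TK.
    have [|y' [/hQ Qy' hy']] := h2.
      by exists (fun i => nth c y (i - a)); apply/hA; rewrite TK.
    exists (T a y'); split=> // z Fz; rewrite -(TK b z); apply/heq/hy'/hQ'.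
    by rewrite TK.
  - split=> [y /hQ Fy|[y /hA Py]]; first exact/hA/h1.
    have [|y' [Fy' hy']] := h2; first by exists (T a y).
    exists (fun i => nth c y' (i - a)); split; first by apply/hQ; rewrite TK.
    by move=> z /hQ' Fz; apply/heq; rewrite TK; apply: hy'.
have [x|R hR] := hN phi (Sigma11_arith aphi) (fun=> c) E1 m n.
  have [[y Py]|nP] := EM (exists y, sval Pd (cat_tuple x y)).
    have Dy : D [set y : n.+1.-tuple M] by apply: D_set1.
    exists (exist _ _ Dy); apply/sem; split=> [_ ->//|_].
    by exists y; split=> // z ->.
  exists (defcut n.+1 (FNot (FEq (TVar 0) (TVar 0))) (fun=> c)); apply/sem.
  by split=> // y [].
have [th1 [e1 ER]] := svalP R.
pose t1 i := if i < m then Some i else if m < i < m.+1 + n.+1 then Some i.-1 else None.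
have ht1 i u : t1 i = Some u -> u < m + n.+1.
  by rewrite /t1; case: ifP => [? [<-]|_]; [lia|case: ifP => // ? [<-]; lia].
(* The dummy coordinate is removed again by giving it the fixed value [c]. *)
pose P' := [set u : (m + n.+1).-tuple M |
  sat (fun i => oapp (nth ([eta e1 with m |-> c] i) u)
    ([eta e1 with m |-> c] i) (t1 i)) th1].
have P'E (x : m.-tuple M) (y : n.+1.-tuple M) :
    P' (cat_tuple x y) <-> sval R (cat_tuple (rcons_tuple x c) y).
  rewrite ER /P' /defset /mkset; apply: sat_fv => i _.
  rewrite /t1 /assign /= nth_cat size_rcons size_tuple ltnS nth_rcons size_tuple.
  have [im|im|->] := ltngtP i m => /=.
  - by rewrite nth_cat size_tuple im; apply: set_nth_default; rewrite size_tuple.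
  - case: ifP => [h|h] /=; last by rewrite nth_default// size_tuple; lia.
    rewrite nth_cat size_tuple ifF; last by lia.
    rewrite (_ : i.-1 - m = i - m.+1); last by lia.
    by apply: set_nth_default; rewrite size_tuple; lia.
  - by rewrite ?eqxx.
exists P'; have key (x : m.-tuple M) : (forall y : n.+1.-tuple M,
      P' (cat_tuple x y) -> P (cat_tuple x y)) /\
    ((exists y : n.+1.-tuple M, P (cat_tuple x y)) ->
      exists! y : n.+1.-tuple M, P' (cat_tuple x y)).
  have DF := @D_section m.+1 n.+1 (sval R) (rcons_tuple x c) (svalP R).
  have /sem[h1 h2] := hR (rcons_tuple x c) (exist _ _ DF) (fun y => iff_refl _).
  split=> [y /P'E/h1/PdE//|[y /PdE Py]].
  have [|y' [/P'E Ry' hy']] := h2; first by exists y.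
  by exists y'; split=> // z /P'E/hy'.
split; first exact: D_subst ht1.
  by move=> x; apply: (key x).1.
by move=> x; apply: (key x).2.
Qed.

End Skolem.

(** * Choice from Skolem functions *)

Section Choice.
Variables (L : language) (M : structure L).
Variable d : {X : set (1.-tuple M) | @D L M 1 X} -> M.
Local Notation N := (so_of d).

(* The sections at x of the relation obtained are those of G, with the parameters
   z picked by P', when x is in X, and those of R' otherwise. *)
Lemma rel_by_cases k m v (X : rel_of N k) (P' : rel_of N (k + v)) (G : rel_of N (m + v))
    (R' : rel_of N (k + m.+1)) : arith_comprehension N ->
  exists R : rel_of N (k + m.+1), forall (x : k.+1.-tuple N) (y : m.+1.-tuple N),
    sval R (cat_tuple x y) <->
    (sval X x /\ exists z : v.-tuple N,
       sval P' (cat_tuple x z : (k + v).+1.-tuple N) /\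
       sval G (cat_tuple y z : (m + v).+1.-tuple N)) \/
    (~ sval X x /\ sval R' (cat_tuple x y)).
Proof.
move=> hN; have [c] := carrier_inh M.
pose a := k.+1 + m.+1.
have aX := @adef_mem N k 0 id.
have aP := @adef_mem N (k + v) 1 (fun i => if i < k.+1 then i else a + (i - k.+1)).
have aG := @adef_mem N (m + v) 2 (fun i => k.+1 + i).
have aR := @adef_mem N (k + m.+1) 3 id.
have [phi aphi hphi] := adef_or (adef_and aX (adef_exs (iota a v) (adef_and aP aG)))
  (adef_and (adef_not aX) aR).
pose E0 n (j : nat) : rel_of N n := defcut n.+1 (FEq (TVar 0) (TVar 0)) (fun=> c).
pose E1 : forall n, nat -> rel_of N n := set_rel E0 0 X.
pose E2 : forall n, nat -> rel_of N n := set_rel E1 1 P'.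
pose E3 : forall n, nat -> rel_of N n := set_rel E2 2 G.
pose E4 : forall n, nat -> rel_of N n := set_rel E3 3 R'.
(* The four relations are kept apart by their numbers, since their arities may coincide. *)
have neq n n' i j : i != j -> (n, i) != (n', j) by rewrite xpair_eqE andbC => /negPf ->.
have [R hR] := hN phi aphi (fun=> c) E4 (k + m.+1); exists R => x y.
rewrite hR -hphi.
have -> : E4 k 0 = X.
  by rewrite /E4 set_rel_neq ?neq// /E3 set_rel_neq ?neq// /E2 set_rel_neq ?neq//
    /E1 set_rel_eq.
have -> : E4 (k + v) 1 = P'.
  by rewrite /E4 set_rel_neq ?neq// /E3 set_rel_neq ?neq// /E2 set_rel_eq.
have -> : E4 (m + v) 2 = G by rewrite /E4 /E3 set_rel_neq ?neq// /E2 set_rel_eq.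
have -> : E4 (k + m.+1) 3 = R' by rewrite /E4 set_rel_eq.
pose e := assign (cat_tuple x y) (fun=> c).
rewrite -/e.
have ex i : i < k.+1 -> e i = nth c x i.
  by move=> ik; rewrite /e /assign nth_cat size_tuple ik.
have ey i : i < m.+1 -> e (k.+1 + i) = nth c y i.
  move=> im; rewrite /e /assign nth_cat size_tuple ifF ?addKn//.
  by apply/negbTE; rewrite -leqNgt leq_addr.
have -> : [tuple e i | i < k.+1] = x.
  by apply: (eq_tuple_nth (x0 := c)) => i ik; rewrite nth_mktuple_lt// ex.
have -> : [tuple e i | i < (k + m.+1).+1] = cat_tuple x y.
  apply: (eq_tuple_nth (x0 := c)) => i ik; rewrite nth_mktuple_lt//.
have eP z : [tuple mix (mem (iota a v)) z e
      (if i < k.+1 then (i : nat) else a + (i - k.+1)) | i < (k + v).+1] =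
    cat_tuple x [tuple z (a + i) | i < v].
  apply: (eq_tuple_nth (x0 := c)) => i ik.
  rewrite (nth_mktuple_lt _ (fun i => mix (mem (iota a v)) z e
    (if i < k.+1 then i else a + (i - k.+1))))// nth_cat size_tuple.
  case: ltnP => h; first by rewrite mix_out ?ex// mem_iota; lia.
  rewrite mix_in; last by rewrite mem_iota; lia.
  by rewrite (nth_mktuple_lt _ (fun i => z (a + i)))//; lia.
have eG z : [tuple mix (mem (iota a v)) z e (k.+1 + i) | i < (m + v).+1] =
    cat_tuple y [tuple z (a + i) | i < v].
  apply: (eq_tuple_nth (x0 := c)) => i ik.
  rewrite (nth_mktuple_lt _ (fun i => mix (mem (iota a v)) z e (k.+1 + i)))//.
  rewrite nth_cat size_tuple.
  case: ltnP => h; first by rewrite mix_out ?ey// mem_iota; lia.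
  rewrite mix_in; last by rewrite mem_iota; lia.
  by rewrite (nth_mktuple_lt _ (fun i => z (a + i))); [congr z|]; lia.
suff -> : (exists z, sval P' [tuple mix (mem (iota a v)) z e
      (if i < k.+1 then (i : nat) else a + (i - k.+1)) | i < (k + v).+1] /\
      sval G [tuple mix (mem (iota a v)) z e (k.+1 + i) | i < (m + v).+1]) <->
  exists z : v.-tuple N, sval P' (cat_tuple x z : (k + v).+1.-tuple N) /\
       sval G (cat_tuple y z : (m + v).+1.-tuple N) by [].
split=> [[z]|[z [h1 h2]]]; first by rewrite eP eG; exists [tuple z (a + i) | i < v].
exists (fun i => nth c z (i - a)); rewrite eP eG.
suff -> : [tuple nth c z (a + i - a) | i < v] = z by [].
apply: (eq_tuple_nth (x0 := c)) => i ik.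
by rewrite (nth_mktuple_lt _ (fun i => nth c z (a + i - a)))// addKn.
Qed.

Variable U : uniform d.

(** The chosen relation P is treated as witness number 0 and the quantified ones are counted from 1.
    Then [p w] relates x to parameters z with which [rho 0 m w] defines a correct P, and a Skolem
    function for [p w] selects one z for each x. *)
Lemma choice_of_skolem : arith_comprehension N -> definable_skolem M ->
  Sigma11_choice N.
Proof.
move=> hN hM phi sphi e E k m hphi.
pose B := maxn k.+1 (maxn m.+1 (so_size phi)).
have pB : so_size phi <= B by lia.
have kB : k < B by lia.
have mB : m < B by lia.
have [|K1 [e0 [R [rho [[K01 e0b] hR hrho rE hits]]]]] := @setup _ _ _ U B (3 * B) e E.
  by lia.
have hR1 n j : n < B -> j < B ->
    good (update_rel R m 0 (rho 0 m) n j) /\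
    indep (3 * B) n.+1 (update_rel R m 0 (rho 0 m) n j).
  rewrite /update_rel; case: eqP => [[-> _] _ _|_]; last exact: hR.
  by split; [apply: (hrho 0 m).1|apply: indep_le (hrho 0 m).2].
have [|S [r [[p gp hS] sS cS]]] :=
    @sigma_udef _ _ _ U B (3 * B) _ rho phi 1 sphi pB (leqnn _) hR1.
  by move=> i n; split; [apply: (hrho i n).1|apply: indep_le (hrho i n).2].
have obj (x : k.+1.-tuple N) (e' : nat -> M) : (forall i, i < K1 -> e' i = e0 i) ->
    forall i, i < B -> assign x e i = assign (x : k.+1.-tuple M) e' i.
  move=> h i iB; have [ik|ki] := ltnP i k.+1; first exact: assign_lt.
  by rewrite !assign_ge// h ?e0b//; lia.
have repE (x : k.+1.-tuple M) (e' : nat -> M) w (P : rel_of N m) :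
    (forall i, i < K1 -> e' i = e0 i) ->
    sval P = defset m.+1 (rho 0 m w) e' ->
    represents B (update_rel R m 0 (rho 0 m)) w (assign x e') (set_rel E 0 P).
  move=> h hP; apply: represents_set.
    by apply: rE => i hi; rewrite assign_ge ?h//; lia.
  by rewrite hP; apply: (hrho 0 m).2 => i Ki; rewrite assign_ge//; lia.
have sound (x : k.+1.-tuple N) w (e' : nat -> M) (P : rel_of N m) :
    (forall i, i < K1 -> e' i = e0 i) ->
    sat (assign (x : k.+1.-tuple M) e') (p w) ->
    sval P = defset m.+1 (rho 0 m w) e' ->
    so_sat (assign x e) (set_rel E 0 P) phi.
  by move=> h /hS hs hP; apply: sS (repE _ _ _ _ h hP) (obj _ _ h) hs.
have [q [gq fq hq]] := good_close K1 gp.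
have [|m' [W hW]] := good_compact (n := k.+1) (K := K1) (e := e0) gq fq.
  move=> x; have [P /cS[Q QB hQ]] := hphi x.
  (* The maximum with 1 keeps P itself among the relations defined, whatever r is. *)
  have [|w [e' [h hw]]] := hits (maxn r 1) (fun i =>
    if i is 0 then existT _ m P else Q i).
    by case=> [|i]; [exact: mB|apply: QB].
  exists w; apply/hq; exists (assign x e') => [i iK|].
    have [ik|ki] := ltnP i k.+1; first exact: assign_lt.
    by rewrite !assign_ge// h.
  apply/hS/hQ => [||i /andP[i1 ir]]; last 1 first.
  - have := hw i; rewrite leq_max ir; case: i i1 {ir} => // i _ /(_ isT).
    rewrite /defines_witness => ->; apply: (hrho _ _).2 => j Kj.
    by rewrite assign_ge//; lia.
  - by apply: repE => //; apply: (hw 0); rewrite leq_max orbT.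
  - exact: obj.
suff [R' hR'] : exists R' : rel_of N (k + m.+1), forall x : k.+1.-tuple N,
    (exists2 i, i < m' & sat (assign (x : k.+1.-tuple M) e0) (q (W i))) ->
    forall P : rel_of N m, (forall y, sval P y <-> sval R' (cat_tuple x y)) ->
    so_sat (assign x e) (set_rel E 0 P) phi.
  by exists R' => x P; apply: hR'; apply: hW.
(* The pieces of the finite cover may overlap; the last one takes precedence and the earlier ones
   only serve points outside it. *)
elim: m' {hW} => [|n [R' IH]]; first by exists (E (k + m.+1) 0) => x [].
have [V1 hV1] := seq_ub (fv (p (W n))).
have [V2 hV2] := seq_ub (fv (rho 0 m (W n))).
(* Enough parameters for both [p w] and [rho 0 m w], which must be given the same z. *)
pose v := maxn V1 V2; set w := W n in hV1 hV2 IH *.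
pose ins (z : v.-tuple M) i := if K1 <= i < K1 + v then nth (e0 i) z (i - K1) else e0 i.
(* The parameters from [K1] on become coordinates, placed after the a.+1 displayed ones. *)
pose t a i := if i < a.+1 then Some i else
  if K1 <= i < K1 + v then Some (a.+1 + (i - K1)) else None.
have ht a i b : t a i = Some b -> b < a.+1 + v.
  by rewrite /t; case: ifP => [? [<-]|_]; [lia|case: ifP => // ? [<-]; lia].
have insE a (x : a.+1.-tuple M) z : a.+1 <= K1 ->
    (fun i => oapp (nth (e0 i) (cat_tuple x z)) (e0 i) (t a i)) = assign x (ins z).
  move=> aK; apply/funext => i; rewrite /t.
  have [ia|ai] := ltnP i a.+1 => /=.
    by rewrite nth_cat size_tuple ia; apply: set_nth_default; rewrite size_tuple.
  rewrite assign_ge// /ins; case: ifP => //= _.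
  by rewrite nth_cat size_tuple ltnNge leq_addr addKn.
have [P' [DP' P'P P'ex]] := hM k.+1 v _ (D_subst (p w) e0 (ht k)).
pose P'r : rel_of N (k + v) := exist _ P' DP'.
pose G : rel_of N (m + v) := exist _ _ (D_subst (rho 0 m w) e0 (ht m)).
have [R2 hR2] := rel_by_cases (defcut k.+1 (q w) e0 : rel_of N k) P'r G R' hN.
have kK : k.+1 <= K1 by lia.
have mK : m.+1 <= K1 by lia.
exists R2 => x hx P hP; have [qx|nqx] := EM (sat (assign (x : k.+1.-tuple M) e0) (q w)).
  have /P'ex[z [P'z zuniq]] : exists z : v.-tuple M,
      sat (fun i => oapp (nth (e0 i) (cat_tuple (x : k.+1.-tuple M) z)) (e0 i) (t k i))
        (p w).
    have /hq[e' e'0 pe'] := qx; exists [tuple e' (K1 + i) | i < v].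
    rewrite insE//; move: pe'; apply: (sat_fv _).1 => i ip.
    have [iK|Ki] := ltnP i K1.
      rewrite e'0//; have [ik|ki] := ltnP i k.+1; first exact: assign_lt.
      by rewrite !assign_ge// /ins ifF//; lia.
    have iv : i < K1 + v by have := hV1 i ip; lia.
    rewrite assign_ge; last by lia.
    rewrite /ins Ki iv (nth_mktuple_lt _ (fun i => e' (K1 + i))) ?subnKC//; lia.
  have := P'P _ _ P'z; rewrite /mkset insE// => pz.
  apply: sound pz _ => [i iK|]; first by rewrite /ins ifF//; lia.
  (* Uniqueness of z makes the fibre a single section of [G] rather than a union of several. *)
  apply/predeqP => y; rewrite hP hR2; split=> [[[_ [z' [/= P'z' Gz']]]|[]]|ry] //.
    by move: Gz'; rewrite -(zuniq _ P'z') /mkset insE.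
  left; split=> //; exists z; split=> //=.
  by rewrite /mkset insE.
apply: IH => [|y]; last first.
  by rewrite hP hR2; split=> [[[]|[]]|] //; right.
have [i + hi] := hx; rewrite ltnS leq_eqVlt => /predU1P[iE|]; last by exists i.
by case: nqx; rewrite /w -iE.
Qed.

End Choice.

(** * Computability relative to an oracle *)

Import CodeSeq.

(** Functions on plain sequences avoid casts between tuple types; only the values on sequences of
    length n matter. *)
Definition computable_seq (B : nat -> bool) n (F : seq nat -> nat) :=
  computable_in B (fun x : n.-tuple nat => F x).

Section Computable.
Variable B : nat -> bool.
Implicit Types (F G a b : seq nat -> nat).
Local Notation cp := (computable_seq B).

Lemma cp_ext n F G : (forall s, size s = n -> F s = G s) -> cp n F -> cp n G.
Proof.
move=> h; rewrite /computable_seq; congr computable_in; apply/funext => x.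
by rewrite h ?size_tuple.
Qed.

Lemma cp_var n i : i < n -> cp n (fun s => nth 0 s i).
Proof.
move=> ltin; rewrite /computable_seq.
rewrite (_ : (fun x : n.-tuple nat => _) = fun x => tnth x (Ordinal ltin)).
  exact: comp_proj.
by apply/funext => x; rewrite (tnth_nth 0).
Qed.

Lemma enum_mkseq T (f : nat -> T) n : [seq f i | i : 'I_n <- enum 'I_n] = mkseq f n.
Proof. by rewrite (map_comp f val) val_enum_ord. Qed.

Lemma cp_comp m n F (G : nat -> seq nat -> nat) :
  cp m F -> (forall i, i < m -> cp n (G i)) -> cp n (fun s => F (mkseq (G^~ s) m)).
Proof.
move=> hF hG; have := comp_comp (g := fun i => fun x : n.-tuple nat => G i x) hF
  (fun i => hG i (ltn_ord i)).
rewrite /computable_seq; congr computable_in; apply/funext => x /=; congr F.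
exact: (enum_mkseq (fun i => G i x)).
Qed.

Lemma cp_op1 n (f : nat -> nat) a :
  cp 1 (fun s => f (nth 0 s 0)) -> cp n a -> cp n (fun s => f (a s)).
Proof. by move=> hf ha; apply: (cp_comp (G := fun _ => a) hf). Qed.

Lemma cp_op2 n (f : nat -> nat -> nat) a b :
  cp 2 (fun s => f (nth 0 s 0) (nth 0 s 1)) -> cp n a -> cp n b ->
  cp n (fun s => f (a s) (b s)).
Proof.
move=> hf ha hb.
by apply: (cp_comp (G := fun i => if i is 0 then a else b) hf) => -[|[]].
Qed.

Lemma cp_S n a : cp n a -> cp n (fun s => (a s).+1).
Proof.
apply: (@cp_op1 n succn); have := comp_succ B; rewrite /computable_seq.
by congr computable_in; apply/funext => x; rewrite /thead (tnth_nth 0).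
Qed.

Lemma cp_cst n c : cp n (fun _ => c).
Proof.
elim: c => [|c IH]; last exact: (cp_S IH).
apply: (cp_comp (m := 0) (F := fun=> 0) (G := fun _ _ => 0)) => //.
exact: comp_zero.
Qed.

Lemma mkseq_cons_nth n a (s : seq nat) : size s = n ->
  mkseq (fun i => if i is j.+1 then nth 0 s j else a s) n.+1 = a s :: s.
Proof.
move=> <-; apply: (@eq_from_nth _ 0); rewrite size_mkseq//.
by move=> [|i] hi; rewrite nth_mkseq.
Qed.

Lemma cp_cons n F a : cp n.+1 F -> cp n a -> cp n (fun s => F (a s :: s)).
Proof.
move=> hF ha; apply: (cp_ext (F := fun s => F (mkseq (fun i =>
    if i is j.+1 then nth 0 s j else a s) n.+1))) => [s hs|].
  by rewrite (mkseq_cons_nth a hs).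
apply: (cp_comp (G := fun i s => if i is j.+1 then nth 0 s j else a s) hF).
by case=> // i hi; apply: cp_var.
Qed.

(** In the body of a recursion the counter and the accumulator precede the arguments; [drop j]
    recovers the latter. *)
Lemma cp_cons_drop j n F a :
  cp n.+1 F -> cp (j + n) a -> cp (j + n) (fun s => F (a s :: drop j s)).
Proof.
move=> hF ha; apply: (cp_ext (F := fun s => F (mkseq (fun i =>
    if i is k.+1 then nth 0 s (j + k) else a s) n.+1))) => [s hs|].
  rewrite -(@mkseq_cons_nth n (fun=> a s)) ?size_drop ?hs ?addKn//.
  by congr F; apply: eq_map => -[|k]; rewrite ?nth_drop.
apply: (cp_comp (G := fun i s => if i is k.+1 then nth 0 s (j + k) else a s) hF).
by case=> // i hi; apply: cp_var; rewrite ltn_add2l.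
Qed.

Lemma cp_drop j n F : cp n F -> cp (j + n) (fun s => F (drop j s)).
Proof.
move=> hF; apply: (cp_ext (F := fun s => F (mkseq (fun i => nth 0 s (j + i)) n)))
  => [s hs|].
  congr F; apply: (@eq_from_nth _ 0); rewrite size_mkseq ?size_drop ?hs ?addKn//.
  by move=> i hi; rewrite nth_mkseq ?nth_drop.
apply: (cp_comp (G := fun i s => nth 0 s (j + i)) hF) => i hi.
by apply: cp_var; rewrite ltn_add2l.
Qed.

Lemma cp_prec n F a b : cp n a -> cp n.+2 F -> cp n b ->
  cp n (fun s => iteri (a s) (fun k r => F (k :: r :: s)) (b s)).
Proof.
move=> ha hF hb.
suff h : cp n.+1 (fun s => iteri (head 0 s) (fun k r => F (k :: r :: behead s))
    (b (behead s))) by apply: (cp_cons h ha).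
have := comp_prec hb hF; rewrite /computable_seq; congr computable_in; apply/funext => x.
by case: (tupleP x) => y t /=; rewrite theadE.
Qed.

Lemma cp_min n F a : cp n.+1 F ->
  (forall s, size s = n -> F (a s :: s) = 0 /\
    forall y, F (y :: s) = 0 -> a s <= y) -> cp n a.
Proof.
move=> hF ha.
have reg (x : n.-tuple nat) : exists y, F (cons_tuple y x) == 0.
  by exists (a x); apply/eqP; apply: (ha _ (size_tuple x)).1.
have := comp_min reg hF; rewrite /computable_seq; congr computable_in; apply/funext => x.
have [h1 h2] := ha _ (size_tuple x); case: ex_minnP => y /eqP hy hmin.
by apply/eqP; rewrite eqn_leq h2// hmin//= h1.
Qed.


Lemma cp_iter n (f : nat -> nat) a b :
  cp 1 (fun s => f (nth 0 s 0)) -> cp n a -> cp n b ->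
  cp n (fun s => iter (a s) f (b s)).
Proof.
move=> hf ha hb; have hr : cp n.+2 (fun s => f (nth 0 s 1)).
  by apply: cp_op1 => //; apply: cp_var.
apply: cp_ext (cp_prec ha hr hb) => s _ /=.
by elim: (a s) => //= k ->.
Qed.

Lemma cp_add n a b : cp n a -> cp n b -> cp n (fun s => a s + b s).
Proof.
move=> ha hb; apply: cp_ext (cp_iter (f := succn) _ ha hb) => [s _|].
  by elim: (a s) => //= k ->; rewrite addSn.
by apply: cp_S; apply: cp_var.
Qed.

Lemma cp_pred n a : cp n a -> cp n (fun s => (a s).-1).
Proof.
move=> ha; have hr : cp n.+2 (fun s => nth 0 s 0) by apply: cp_var.
by apply: cp_ext (cp_prec ha hr (cp_cst _ 0)) => s _ /=; case: (a s).
Qed.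

Lemma cp_sub n a b : cp n a -> cp n b -> cp n (fun s => a s - b s).
Proof.
move=> ha hb; apply: cp_ext (cp_iter (f := predn) _ hb ha) => [s _|].
  by elim: (b s) => [|k /= ->]; rewrite ?subn0 ?subnS.
by apply: cp_pred; apply: cp_var.
Qed.

Lemma cp_mul n a b : cp n a -> cp n b -> cp n (fun s => a s * b s).
Proof.
move=> ha hb; have hr : cp n.+2 (fun s => b (drop 2 s) + nth 0 s 1).
  by apply: cp_add; [apply: (cp_drop 2)|apply: cp_var].
apply: cp_ext (cp_prec ha hr (cp_cst _ 0)) => s _ /=.
by rewrite drop0; elim: (a s) => //= k ->; rewrite mulSn.
Qed.

Lemma cp_exp2 n a : cp n a -> cp n (fun s => 2 ^ a s).
Proof.
move=> ha; apply: cp_ext (cp_iter (f := fun m => m + m) _ ha (cp_cst _ 1)) => [s _|].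
  by elim: (a s) => //= k ->; rewrite addnn -mul2n expnS.
by apply: cp_add; apply: cp_var.
Qed.

(** One layer of [CodeSeq.code], and a bijection from pairs onto the positive numbers. *)
Definition cpair (h t : nat) := 2 ^ h * t.*2.+1.

Lemma code_cons h s : code (h :: s) = cpair h (code s). Proof. by []. Qed.

Lemma cp_pair n a b : cp n a -> cp n b -> cp n (fun s => cpair (a s) (b s)).
Proof.
move=> ha hb; apply: cp_mul; first exact: cp_exp2.
apply: cp_ext (cp_S (cp_add hb hb)) => s _.
by rewrite addnn.
Qed.

Lemma cp_neg n (p : seq nat -> bool) : cp n p -> cp n (fun s => ~~ p s).
Proof.
by move=> hp; apply: cp_ext (cp_sub (cp_cst _ 1) hp) => s _; case: (p s).
Qed.

Lemma cp_andb n (p q : seq nat -> bool) : cp n p -> cp n q ->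
  cp n (fun s => p s && q s).
Proof.
by move=> hp hq; apply: cp_ext (cp_mul hp hq) => s _; case: (p s); case: (q s).
Qed.

Lemma cp_orb n (p q : seq nat -> bool) : cp n p -> cp n q ->
  cp n (fun s => p s || q s).
Proof.
move=> hp hq; apply: cp_ext (cp_neg (cp_andb (cp_neg hp) (cp_neg hq))) => s _.
by rewrite negb_and !negbK.
Qed.

Lemma cp_eq0 n a : cp n a -> cp n (fun s => a s == 0).
Proof.
by move=> ha; apply: cp_ext (cp_sub (cp_cst _ 1) ha) => s _; case: (a s).
Qed.

Lemma cp_eq n a b : cp n a -> cp n b -> cp n (fun s => a s == b s).
Proof.
move=> ha hb; apply: cp_ext (cp_eq0 (cp_add (cp_sub ha hb) (cp_sub hb ha))) => s _.
by rewrite addn_eq0 [a s == _]eqn_leq.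
Qed.

Lemma cp_if n (p : seq nat -> bool) a b : cp n p -> cp n a -> cp n b ->
  cp n (fun s => if p s then a s else b s).
Proof.
move=> hp ha hb; apply: cp_ext (cp_add (cp_mul hp ha) (cp_mul (cp_neg hp) hb)) => s _.
by case: (p s); rewrite ?mul1n ?mul0n ?addn0.
Qed.

Lemma cp_has n (p : seq nat -> bool) a : cp n.+1 p -> cp n a ->
  cp n (fun s => has (fun y => p (y :: s)) (iota 0 (a s))).
Proof.
move=> hp ha.
have hr : cp n.+2 (fun s => (nth 0 s 1 != 0) || p (nth 0 s 0 :: drop 2 s)).
  apply: cp_orb; first by apply: cp_neg; apply: cp_eq0; apply: cp_var.
  by apply: (@cp_cons_drop 2 n p) => //; apply: cp_var.
apply: cp_ext (cp_prec ha hr (cp_cst _ 0)) => s _ /=; rewrite drop0.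
elim: (a s) => // k IH; rewrite -[in RHS]addn1 iotaD has_cat /= IH orbF add0n.
by case: has.
Qed.

Definition chead (u : nat) := head 0 (decode u).
Definition ctail (u : nat) := code (behead (decode u)).

Lemma cpair_head h t : chead (cpair h t) = h.
Proof. by rewrite -[t]decodeK -code_cons /chead codeK. Qed.

Lemma cpair_tail h t : ctail (cpair h t) = t.
Proof. by rewrite -{1}[t]decodeK -code_cons /ctail codeK /= decodeK. Qed.

Lemma cpairK u : 0 < u -> cpair (chead u) (ctail u) = u.
Proof.
rewrite -{1 4}[u]decodeK /chead /ctail.
by case: (decode u) => [|h s] //= _; rewrite -code_cons.
Qed.

Lemma cpair_gt h t : (h < cpair h t) && (t < cpair h t).
Proof.
have := ltn_code (h :: decode t); rewrite code_cons decodeK /= => /andP[-> _] /=.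
have : 0 < 2 ^ h by rewrite expn_gt0.
rewrite /cpair; case: (2 ^ h) => // k _; rewrite mulSn -addnn.
by rewrite addSn ltnS -addnA leq_addr.
Qed.

Lemma chead_le u : chead u <= u.
Proof.
case: (posnP u) => [->|/cpairK]//; have := cpair_gt (chead u) (ctail u).
by move=> /andP[/ltnW h _] E; rewrite E in h.
Qed.

Lemma ctail_le u : ctail u <= u.
Proof.
case: (posnP u) => [->|/cpairK]//; have := cpair_gt (chead u) (ctail u).
by move=> /andP[_ /ltnW h] E; rewrite E in h.
Qed.

Lemma ctail_lt u : 0 < u -> ctail u < u.
Proof.
by move=> /cpairK E; have := cpair_gt (chead u) (ctail u); rewrite E => /andP[].
Qed.

Lemma chead_lt u : 0 < u -> chead u < u.
Proof.
by move=> /cpairK E; have := cpair_gt (chead u) (ctail u); rewrite E => /andP[].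
Qed.

(** For u > 0 the head is the only y with [cpair y t = u] for some t, and such a t lies below u. A
    bounded search thus tests each candidate, and minimization finds the head; for u = 0 it returns
    0. *)
Lemma cp_chead n a : cp n a -> cp n (fun s => chead (a s)).
Proof.
apply: (@cp_op1 n chead).
apply: (cp_min (F := fun s => (nth 0 s 1 != 0) && ~~ has
    (fun y => (fun t => cpair (nth 0 t 1) (nth 0 t 0) == nth 0 t 2) (y :: s))
    (iota 0 (nth 0 s 1)))).
  apply: cp_andb; first by apply: cp_neg; apply: cp_eq0; apply: cp_var.
  apply: cp_neg; apply: (cp_has (p := fun t => cpair (nth 0 t 1) (nth 0 t 0) == nth 0 t 2));
    last exact: cp_var.
  by apply: cp_eq; [apply: cp_pair|]; apply: cp_var.
case=> [|u []]//= _; case: (posnP u) => [->|u0] //=.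
split=> [|y].
  suff -> : has (fun y => cpair (chead u) y == u) (iota 0 u) by [].
  apply/hasP; exists (ctail u); first by rewrite mem_iota ctail_lt.
  by rewrite cpairK.
case: hasP => // -[t _ /eqP <-] _.
by rewrite cpair_head.
Qed.

Lemma cp_ctail n a : cp n a -> cp n (fun s => ctail (a s)).
Proof.
apply: (@cp_op1 n ctail).
apply: (cp_min (F := fun s => (nth 0 s 1 != 0) && ~~ has
    (fun y => (fun t => cpair (nth 0 t 0) (nth 0 t 1) == nth 0 t 2) (y :: s))
    (iota 0 (nth 0 s 1)))).
  apply: cp_andb; first by apply: cp_neg; apply: cp_eq0; apply: cp_var.
  apply: cp_neg; apply: (cp_has (p := fun t => cpair (nth 0 t 0) (nth 0 t 1) == nth 0 t 2));
    last exact: cp_var.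
  by apply: cp_eq; [apply: cp_pair|]; apply: cp_var.
case=> [|u []]//= _; case: (posnP u) => [->|u0] //=.
split=> [|y].
  suff -> : has (fun y => cpair y (ctail u) == u) (iota 0 u) by [].
  apply/hasP; exists (chead u); first by rewrite mem_iota chead_lt.
  by rewrite cpairK.
case: hasP => // -[t _ /eqP <-] _.
by rewrite cpair_tail.
Qed.

Definition cnth (u i : nat) := nth 0 (decode u) i.

Lemma cp_cnth n a b : cp n a -> cp n b -> cp n (fun s => cnth (a s) (b s)).
Proof.
move=> ha hb; have ht : cp 1 (fun s => ctail (nth 0 s 0)).
  by apply: cp_ctail; apply: cp_var.
apply: cp_ext (cp_chead (cp_iter ht hb ha)) => s _.
rewrite /chead /cnth -nth0.
suff -> : decode (iter (b s) ctail (a s)) = drop (b s) (decode (a s)).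
  by rewrite nth_drop addn0.
elim: (b s) => [|k IH]; first by rewrite drop0.
by rewrite iterS /ctail IH codeK -drop1 drop_drop.
Qed.

Lemma cnth_le u i : cnth u i <= u.
Proof.
rewrite /cnth; have [hi|hi] := ltnP i (size (decode u)); last by rewrite nth_default.
by apply/ltnW/(allP (gtn_decode u))/mem_nth.
Qed.

(** [foldr] consumes the list from its end while [iteri] counts upwards, hence the reversed
    index. *)
Lemma foldr_iota T (f : nat -> T -> T) z k n :
  foldr f z (iota k n) = iteri n (fun i r => f (k + (n - i.+1)) r) z.
Proof.
(* Induction on the length m of the final segment already folded. *)
suff h m : m <= n -> foldr f z (iota (k + (n - m)) m) =
    iteri m (fun i r => f (k + (n - i.+1)) r) z.
  by rewrite -h// subnn addn0.
elim: m => //= m IH ltmn; rewrite -IH 1?ltnW//.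
by rewrite -addnS -subSn.
Qed.

Lemma cp_foldr_iota n (f : seq nat -> nat) a b k :
  cp n.+2 f -> cp n a -> cp n b ->
  cp n (fun s => foldr (fun i r => f (i :: r :: s)) (b s) (iota k (a s))).
Proof.
move=> hf ha hb.
have hr : cp n.+2 (fun s => f ((k + (a (drop 2 s) - (nth 0 s 0).+1)) :: drop 1 s)).
  apply: (@cp_cons_drop 1 n.+1 f) => //; apply: cp_add; first exact: cp_cst.
  by apply: cp_sub; [apply: (cp_drop 2)|apply: cp_S; apply: cp_var].
apply: cp_ext (cp_prec ha hr hb) => s _; rewrite foldr_iota; apply: eq_iteri => i r /=.
by rewrite !drop0.
Qed.

Lemma cp_mkseq n (f : seq nat -> nat) a : cp n.+1 f -> cp n a ->
  cp n (fun s => code (mkseq (fun i => f (i :: s)) (a s))).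
Proof.
move=> hf ha.
have hr : cp n.+2 (fun s => cpair (f (nth 0 s 0 :: drop 2 s)) (nth 0 s 1)).
  apply: cp_pair; last exact: cp_var.
  by apply: (@cp_cons_drop 2 n f) => //; apply: cp_var.
apply: cp_ext (cp_foldr_iota 0 hr ha (cp_cst _ 0)) => s _ /=.
rewrite drop0 /mkseq; elim: (iota 0 (a s)) => //= i r IH.
by rewrite IH.
Qed.

End Computable.

(* Codes the list of the values of [course_of_values f] below w, last one first. *)
Definition history (f : nat -> nat -> nat) w :=
  iteri w (fun k r => cpair (f k r) r) 0.

Definition course_of_values (f : nat -> nat -> nat) w := f w (history f w).

Lemma cnth_history f w i : i < w -> cnth (history f w) (w - i.+1) = course_of_values f i.
Proof.
suff E : decode (history f w) = rev (mkseq (course_of_values f) w).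
  move=> hi; rewrite /cnth E nth_rev size_mkseq; last first.
    by rewrite subnSK// leq_subr.
  by rewrite subnSK// subKn 1?ltnW// nth_mkseq.
elim: w => // w IH.
have -> : history f w.+1 = cpair (course_of_values f w) (history f w) by [].
by rewrite -[history f w]decodeK -code_cons codeK mkseqS rev_rcons IH.
Qed.

Lemma cp_cov B f : computable_seq B 2 (fun s => f (nth 0 s 0) (nth 0 s 1)) ->
  computable_seq B 1 (fun s => course_of_values f (nth 0 s 0)).
Proof.
move=> hf; apply: cp_op2 => //; first exact: cp_var.
have hr : computable_seq B 3 (fun s => cpair (f (nth 0 s 0) (nth 0 s 1)) (nth 0 s 1)).
  by apply: cp_pair; [apply: (cp_op2 (f := f))|]; try apply: cp_var.
exact: cp_prec (cp_var _ (ltn0Sn 0)) hr (cp_cst _ _ 0).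
Qed.

(** * Computable enumeration of the formulas *)

Lemma cp_computable B (a : 1.-tuple nat -> nat) : computable_in B a ->
  computable_seq B 1 (fun s => a [tuple nth 0 s 0]).
Proof.
rewrite /computable_seq; congr computable_in; apply/funext => x; congr a.
by apply: val_inj; case: x => -[|y []].
Qed.

(* Tag 0 builds a variable and tag k.+1 an application of the function symbol
   number k; indices that denote nothing yield a default value, so that every
   number codes a term. H codes the list of the preceding values in reverse. *)
Definition term_step (af : nat -> nat) (w H : nat) :=
  if chead w == 0 then code [:: 0; ctail w] else
  if af (chead w).-1 == 0 then code [:: 0; 0] else
  code [:: 1, (chead w).-1 &
    mkseq (fun i => cnth H (w - (cnth (ctail w) i).+1)) (af (chead w).-1).-1].

Lemma cp_code_nil B n : computable_seq B n (fun _ => code [::]).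
Proof. exact: cp_cst. Qed.

Lemma cp_code_cons B n a (l : seq nat -> seq nat) : computable_seq B n a ->
  computable_seq B n (fun s => code (l s)) ->
  computable_seq B n (fun s => code (a s :: l s)).
Proof. exact: cp_pair. Qed.

Lemma cp_term_step B af : computable_seq B 1 (fun s => af (nth 0 s 0)) ->
  computable_seq B 2 (fun s => term_step af (nth 0 s 0) (nth 0 s 1)).
Proof.
move=> haf; have hh : computable_seq B 2 (fun s => chead (nth 0 s 0)).
  by apply: cp_chead; apply: cp_var.
have hk := cp_pred hh; have hafk := cp_op1 haf hk.
apply: cp_if; first exact: cp_eq0.
  apply: cp_code_cons (cp_cst _ _ _) (cp_code_cons _ (cp_code_nil _ _)).
  by apply: cp_ctail; apply: cp_var.
apply: cp_if; [exact: cp_eq0|exact: cp_cst|].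
apply: cp_code_cons (cp_cst _ _ _) (cp_code_cons hk _).
apply: (cp_mkseq (f := fun s => cnth (nth 0 s 2)
  (nth 0 s 1 - (cnth (ctail (nth 0 s 1)) (nth 0 s 0)).+1))); last exact: cp_pred.
apply: cp_cnth; [exact: cp_var|apply: cp_sub; first exact: cp_var].
apply: cp_S; apply: cp_cnth; last exact: cp_var.
by apply: cp_ctail; apply: cp_var.
Qed.

Lemma covE f w : course_of_values f w = f w (history f w). Proof. by []. Qed.

Lemma term_covE af w : course_of_values (term_step af) w =
  if chead w == 0 then code [:: 0; ctail w] else
  if af (chead w).-1 == 0 then code [:: 0; 0] else
  code [:: 1, (chead w).-1 &
    mkseq (fun i => course_of_values (term_step af) (cnth (ctail w) i))
      (af (chead w).-1).-1].
Proof.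
rewrite covE /term_step; case: eqP => // /eqP h0; case: eqP => // _.
congr (code [:: _, _ & _]); apply: eq_map => i; apply: cnth_history.
apply: leq_ltn_trans (cnth_le _ _) (ctail_lt _).
by apply: leq_trans (chead_le w); rewrite lt0n.
Qed.

Lemma term_enum B L (c : numbering B L) :
  exists2 f : nat -> nat, computable_seq B 1 (fun s => f (nth 0 s 0)) &
    (forall w, exists t, term_num c t = f w) /\
    (forall t, exists w, f w = term_num c t).
Proof.
have [a /cp_computable ha [afar arn]] := fnum_comp c.
pose af k := a [tuple k]; have {}afar f : af (fnum c f) = (far f).+1 := afar f.
exists (course_of_values (term_step af)).
  exact/cp_cov/cp_term_step.
split.
- elim/ltn_ind => w IH; rewrite term_covE.
  case: eqP => [_|/eqP h0]; first by exists (TVar (ctail w)).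
  case: eqP => [_|/eqP/arn [f fk]]; first by exists (TVar 0).
  have w0 : 0 < w by apply: leq_trans (chead_le w); rewrite lt0n.
  have /choice[ts hts] (i : 'I_(far f)) : exists t,
      term_num c t = course_of_values (term_step af) (cnth (ctail w) i).
    by apply: IH; apply: leq_ltn_trans (cnth_le _ _) (ctail_lt w0).
  exists (TApp ts); rewrite /= -fk afar (eq_map hts).
  by rewrite (enum_mkseq (fun i => course_of_values _ (cnth _ i))).
- elim=> [i|f ts /choice[ws hws]].
    by exists (cpair 0 i); rewrite term_covE cpair_head cpair_tail.
  exists (cpair (fnum c f).+1 (code [seq ws i | i <- enum 'I_(far f)])).
  rewrite term_covE cpair_head cpair_tail /= afar /=.
  set l := mkseq _ _; set l' := map _ _; suff -> : l = l' by [].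
  rewrite /l -enum_mkseq; apply: eq_map => i.
  rewrite -hws /cnth codeK (nth_map i) ?size_enum_ord//.
  by rewrite nth_ord_enum.
Qed.

(** These tags differ from those of [form_num]: 0 to 3 select equality, negation, conjunction and
    quantification, and k + 4 relation symbol number k, with v_0 = v_0 as the default. *)
Definition form_step (tn ar : nat -> nat) (w H : nat) :=
  let v := ctail w in
  let rec i := cnth H (w - i.+1) in
  if chead w == 0 then code [:: 0; tn (chead v); tn (ctail v)] else
  if chead w == 1 then code [:: 2; rec (chead v)] else
  if chead w == 2 then code [:: 3; rec (chead v); rec (ctail v)] else
  if chead w == 3 then code [:: 4; chead v; rec (ctail v)] else
  if ar (chead w - 4) == 0 then code [:: 0; code [:: 0; 0]; code [:: 0; 0]] else
  code [:: 1, chead w - 4 &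
    mkseq (fun i => tn (cnth v i)) (ar (chead w - 4)).-1].

Lemma cp_form_step B tn ar : computable_seq B 1 (fun s => tn (nth 0 s 0)) ->
  computable_seq B 1 (fun s => ar (nth 0 s 0)) ->
  computable_seq B 2 (fun s => form_step tn ar (nth 0 s 0) (nth 0 s 1)).
Proof.
move=> htn har.
have hh : computable_seq B 2 (fun s => chead (nth 0 s 0)).
  by apply: cp_chead; apply: cp_var.
have hv : computable_seq B 2 (fun s => ctail (nth 0 s 0)).
  by apply: cp_ctail; apply: cp_var.
have hrec a : computable_seq B 2 a ->
    computable_seq B 2 (fun s => cnth (nth 0 s 1) (nth 0 s 0 - (a s).+1)).
  by move=> ha; apply: cp_cnth; [|apply: cp_sub; last exact: cp_S]; apply: cp_var.
have hk := cp_sub hh (cp_cst _ _ 4); have hark := cp_op1 har hk.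
have h0 := cp_cst B 2; have ha := cp_chead hv; have hb := cp_ctail hv.
apply: cp_if; first exact: cp_eq.
  by do 3?[apply: cp_code_cons => //]; try apply: cp_op1.
apply: cp_if; first exact: cp_eq.
  by do 3?[apply: cp_code_cons => //]; try apply: hrec.
apply: cp_if; first exact: cp_eq.
  by do 3?[apply: cp_code_cons => //]; try apply: hrec.
apply: cp_if; first exact: cp_eq.
  by do 3?[apply: cp_code_cons => //]; try apply: hrec.
apply: cp_if; [exact: cp_eq0|exact: cp_cst|].
apply: cp_code_cons (h0 _) (cp_code_cons hk _).
apply: (cp_mkseq (f := fun s => tn (cnth (ctail (nth 0 s 1)) (nth 0 s 0))));
  last exact: cp_pred.
apply: cp_op1 => //; apply: cp_cnth; last exact: cp_var.
by apply: cp_ctail; apply: cp_var.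
Qed.

Lemma form_covE tn ar w (f := course_of_values (form_step tn ar)) (v := ctail w) : f w =
  if chead w == 0 then code [:: 0; tn (chead v); tn (ctail v)] else
  if chead w == 1 then code [:: 2; f (chead v)] else
  if chead w == 2 then code [:: 3; f (chead v); f (ctail v)] else
  if chead w == 3 then code [:: 4; chead v; f (ctail v)] else
  if ar (chead w - 4) == 0 then code [:: 0; code [:: 0; 0]; code [:: 0; 0]] else
  code [:: 1, chead w - 4 &
    mkseq (fun i => tn (cnth v i)) (ar (chead w - 4)).-1].
Proof.
rewrite {1}/f covE /form_step -/v -/f; case: eqP => // /eqP h0.
have w0 : 0 < w by apply: leq_trans (chead_le w); rewrite lt0n.
by rewrite !cnth_history// (leq_ltn_trans _ (ctail_lt w0)) ?ctail_le ?chead_le.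
Qed.

(** An enumeration in which every number yields a formula avoids deciding which numbers are codes,
    and turns finite tuples of formulas into tuples of numbers. *)
Lemma form_enum B L (c : numbering B L) :
  exists2 f : nat -> nat, computable_seq B 1 (fun s => f (nth 0 s 0)) &
    (forall w, exists phi, form_num c phi = f w) /\
    (forall phi, exists w, f w = form_num c phi).
Proof.
have [tn htn [tn1 tn2]] := term_enum c.
have [a /cp_computable ha [arar arn]] := rnum_comp c.
pose ar k := a [tuple k]; have {}arar r : ar (rnum c r) = (rar r).+1 := arar r.
exists (course_of_values (form_step tn ar)).
  exact/cp_cov/cp_form_step.
split.
- elim/ltn_ind => w IH; rewrite form_covE; case: eqP => [_|/eqP h0].
    have [t <-] := tn1 (chead (ctail w)); have [u <-] := tn1 (ctail (ctail w)).
    by exists (FEq t u).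
  have w0 : 0 < w by apply: leq_trans (chead_le w); rewrite lt0n.
  have [p hp] := IH _ (leq_ltn_trans (chead_le _) (ctail_lt w0)).
  have [q hq] := IH _ (leq_ltn_trans (ctail_le _) (ctail_lt w0)).
  case: eqP => _; first by exists (FNot p); rewrite /= hp.
  case: eqP => _; first by exists (FAnd p q); rewrite /= hp hq.
  case: eqP => _; first by exists (FEx (chead (ctail w)) q); rewrite /= hq.
  case: eqP => [_|/eqP/arn [r rk]]; first by exists (FEq (TVar 0) (TVar 0)).
  have /choice[ts hts] i : exists t, term_num c t = tn (cnth (ctail w) i) by [].
  exists (FRel [tuple ts i | i < rar r]); rewrite /= -rk arar -map_comp /comp.
  by rewrite (eq_map (fun i : 'I__ => hts i)) (enum_mkseq (fun i => tn (cnth _ i))).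
- elim=> [t u|r ts|p [w hw]|p [w hw] q [x hx]|i p [w hw]].
  + have [w hw] := tn2 t; have [x hx] := tn2 u; exists (cpair 0 (cpair w x)).
    by rewrite form_covE !(cpair_head, cpair_tail) /= hw hx.
  + have [ws hws] : exists ws, map tn ws = map (term_num c) ts.
      elim: (val ts) => [|t s [ws hws]]; first by exists [::].
      by have [w hw] := tn2 t; exists (w :: ws); rewrite /= hw hws.
    exists (cpair (rnum c r).+4 (code ws)).
    rewrite form_covE !(cpair_head, cpair_tail) /= -addn4 addnK arar /=.
    have sz : size ws = rar r by rewrite -(size_map tn) hws size_map size_tuple.
    set l := mkseq _ _; suff -> : l = map (term_num c) ts by [].
    rewrite /l /cnth codeK -hws -sz -[in RHS](mkseq_nth 0 ws).
    by rewrite [in RHS]/mkseq -map_comp.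
  + by exists (cpair 1 (cpair w 0)); rewrite form_covE !(cpair_head, cpair_tail) /= hw.
  + exists (cpair 2 (cpair w x)).
    by rewrite form_covE !(cpair_head, cpair_tail) /= hw hx.
  + by exists (cpair 3 (cpair i w)); rewrite form_covE !(cpair_head, cpair_tail) /= hw.
Qed.

Lemma term_num_inj B L (c : numbering B L) : injective (term_num c).
Proof.
elim=> [i|f ts IH] [j|g us] /(can_inj codeK) // []; first by move->.
move=> /fnum_inj fg; case: g / fg us => us /eq_in_map E.
by congr TApp; apply/funext => i; apply/IH/E; rewrite mem_enum.
Qed.

Lemma form_num_inj B L (c : numbering B L) : injective (form_num c).
Proof.
elim=> [t u|r ts|p IH|p IHp q IHq|i p IH] [t' u'|r' ts'|p'|p' q'|i' p'] 
  /(can_inj codeK) // [].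
- by move=> /term_num_inj -> /term_num_inj ->.
- move=> /rnum_inj rr; case: r' / rr ts' => ts' E; congr FRel; apply: val_inj.
  exact: (inj_map (@term_num_inj _ _ c)).
- by move=> /IH ->.
- by move=> /IHp -> /IHq ->.
- by move=> -> /IH ->.
Qed.

(** * Saturated and recursively saturated structures *)

Lemma finite_set_index T (A : set T) : finite_set A ->
  exists n (f : T -> nat), (forall x, A x -> f x < n) /\
    forall x y, A x -> A y -> f x = f y -> x = y.
Proof.
move=> /finite_set_leP[n] /pcard_leP[f]; exists n, f; split=> [x Ax|x y Ax Ay].
  exact: (@funS _ _ _ _ f x Ax).
by apply: (@inj _ _ _ f); rewrite inE.
Qed.

Lemma finite_tuples T n : finite_set [set: T] -> finite_set [set: n.-tuple T].
Proof.
move=> fT; elim: n => [|n IH].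
  by apply: (sub_finite_set (B := [set [tuple]])) => // x _; apply: tuple0.
apply: (sub_finite_set (B := (fun p => cons_tuple p.1 p.2) @`
    ([set: T] `*` [set: n.-tuple T]))).
  by move=> x _; case: (tupleP x) => a y; exists (a, y) => //; apply: val_inj.
exact/finite_image/finite_setX.
Qed.

Lemma cover_finite T I (A : set T) (P : T -> I -> Prop) : inhabited I -> finite_set A ->
  (forall x, A x -> exists w, P x w) ->
  exists n (W : nat -> I), forall x, A x -> exists2 i, i < n & P x (W i).
Proof.
move=> [w0] /finite_set_index[n [f [fn finj]]] hP.
have /choice[W hW] i : exists w, forall x, A x -> f x = i -> P x w.
  have [[x [Ax fx]]|nA] := EM (exists x, A x /\ f x = i).
    have [w Pw] := hP x Ax; exists w => y Ay fy.
    by rewrite -(finj x y)// fx fy.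
  by exists w0 => x Ax fx; case: nA; exists x.
by exists n, W => x Ax; exists (f x); [apply: fn|apply: hW].
Qed.

(** Without a finite subcover, every finite part of the type P of all negations is realized; a
    realization of P then escapes the cover. [q] is kept apart from the literal negation because the
    recursive case pads it. *)
Lemma compact_cover L (M : structure L) n (e : nat -> M) (I : Type)
    (p q : I -> formula L) (P : set (formula L * (nat -> M))) : inhabited I ->
  (forall w (x : n.-tuple M), sat (assign x e) (q w) <-> ~ sat (assign x e) (p w)) ->
  (forall phie, P phie <-> exists w, phie = (q w, e)) ->
  (finitely_realized n P -> realized n P) ->
  (forall x : n.-tuple M, exists w, sat (assign x e) (p w)) ->
  exists N (W : nat -> I), forall x : n.-tuple M,
    exists2 i, i < N & sat (assign x e) (p (W i)).
Proof.
move=> I0 hq hP hr hp; apply: contrapT => nW.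
have [x hx] : realized n P.
  apply: hr => Q fQ QP.
  have [|N [W hW]] := @cover_finite _ _ Q (fun phie w => phie = (q w, e)) I0 fQ.
    by move=> phie /QP/hP.
  have [x hx] : exists x : n.-tuple M, forall i, i < N -> ~ sat (assign x e) (p (W i)).
    apply: contrapT => /forallNP h; apply: nW; exists N, W => x.
    by have /existsNP[i /not_implyP[iN /contrapT ?]] := h x; exists i.
  by exists x => phie /hW[i iN ->]; apply/hq/hx.
have [w pw] := hp x.
have /hx /hq : P (q w, e) by apply/hP; exists w.
exact.
Qed.

Lemma close_exs L (M : structure L) K n (phi : formula L) :
  (forall i, i \in fv phi -> i < K + n) ->
  (forall i, i \in fv (exs (iota K n) phi) -> i < K) /\
  forall e : nat -> M, sat e (exs (iota K n) phi) <->
    exists2 e', (forall i, i < K -> e' i = e i) & sat e' phi.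
Proof.
move=> h; split=> [i /fv_exs /andP[/h iK]|e]; first by rewrite mem_iota; lia.
rewrite sat_exs; split=> [[y hy]|[e' he hs]].
  by exists (mix (mem (iota K n)) y e) => // i iK; rewrite mix_out// mem_iota; lia.
exists e'; move: hs; apply: (sat_fv _).1 => i ip; have := h i ip => iKn.
have [iK|Ki] := ltnP i K; first by rewrite mix_out ?he// mem_iota; lia.
by rewrite mix_in// mem_iota; lia.
Qed.

Lemma unif_definable_formula L (M : structure L)
    (d : {X : set (1.-tuple M) | @D L M 1 X} -> M) : unif_definable d ->
  forall th, exists th', unif_defines d th th'.
Proof.
move=> hd th; have [K hK] := seq_ub (fv th).
have [|th' _ h] := hd K th; last by exists th'.
by move=> i /hK; lia.
Qed.

(** Nothing has to be computable here, so an index can be a whole sequence of formulas, and every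
    family is good. *)
Lemma saturated_uniform L (M : structure L)
    (d : {X : set (1.-tuple M) | @D L M 1 X} -> M) :
  unif_definable d -> saturated M -> inhabited (uniform d).
Proof.
move=> hd hM; constructor.
apply: (@Uniform _ _ d (nat -> formula L) (fun _ => True)) => //.
- move=> K p _; have /choice[n hn] w := seq_ub (fv (p w)).
  have h w := @close_exs L M K (n w) (p w) (fun i ip => ltn_addl _ (hn w i ip)).
  by exists (fun w => exs (iota K (n w)) (p w)); split=> // w; case: (h w).
- exists (fun i w => w i) => // r t; exists t => //.
- move=> p _; have /choice[F hF] := unif_definable_formula hd.
  by exists (F \o p).
- move=> n K e p _ fp hp.
  have I0 : inhabited (nat -> formula L) by exists; exact: (fun=> FEq (TVar 0) (TVar 0)).
  (* The finite parameter set is smaller than M only if M is infinite; for finite M there are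
     finitely many points to cover. *)
  have [fM|iM] := EM (finite_set [set: M]).
    have [|N [W hW]] := @cover_finite _ _ [set: n.-tuple M]
      (fun x w => sat (assign x e) (p w)) I0 (finite_tuples n fM) _; first by [].
    by exists N, W => x; apply: hW.
  pose P := [set phie | exists w, phie = (FNot (p w), e)].
  apply: (@compact_cover L M n e _ p (fun w => FNot (p w)) P) => //.
  have fA : finite_set (e @` [set i | i < K]) by apply/finite_image/finite_II.
  apply: (hM (e @` [set i | i < K])).
  + by apply: subset_card_le.
  + apply/negP => /eq_finite_set h; apply: iM; rewrite -h; exact: fA.
  + by move=> phi e' [w [-> ->]] i /= /fp iK _; exists i.
Qed.

(** * The recursively saturated case *)

Lemma term_fv_lt_num B L (c : numbering B L) (t : term L) i :
  i \in term_fv t -> i < term_num c t.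
Proof.
elim: t => [j|f ts IH] /=.
  by rewrite inE => /eqP ->; have := ltn_code [:: 0; j] => /and3P[].
move=> /flatten_mapP[k _ /IH h]; apply: ltn_trans h _.
have /allP := ltn_code
  [:: 1, fnum c f & [seq term_num c (ts i0) | i0 <- enum 'I_(far f)]].
by apply; rewrite !inE map_f ?orbT// mem_enum.
Qed.

(** A bound on the free variables that is computable from the code for free: it tells [good_close]
    how many variables to quantify. *)
Lemma fv_lt_num B L (c : numbering B L) (phi : formula L) i :
  i \in fv phi -> i < form_num c phi.
Proof.
elim: phi => [s t|r ts|p IH|p IHp q IHq|j p IH] h; rewrite /= in h.
- have /and4P[_ ls lt _] := ltn_code [:: 0; term_num c s; term_num c t].
  by move: h; rewrite mem_cat => /orP[] /(term_fv_lt_num c) /ltn_trans; apply.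
- rewrite -[form_num _ _]/(code [:: 1, rnum c r & [seq term_num c t | t <- ts]]).
  have /and3P[_ _] := ltn_code [:: 1, rnum c r & [seq term_num c t | t <- ts]].
  move: (code _) => m; elim: (val ts) h => // t s IH.
  rewrite [flatten _]/= mem_cat => /orP[it|/IH h] /andP[lt ls]; last exact: h.
  exact: ltn_trans (term_fv_lt_num c it) lt.
- have /and3P[_ lp _] := ltn_code [:: 2; form_num c p].
  by move: h => /IH /ltn_trans; apply.
- have /and4P[_ lp lq _] := ltn_code [:: 3; form_num c p; form_num c q].
  by move: h; rewrite mem_cat => /orP[/IHp|/IHq] /ltn_trans; apply.
- have /and4P[_ _ lp _] := ltn_code [:: 4; j; form_num c p].
  by move: h; rewrite mem_filter => /andP[_ /IH] /ltn_trans; apply.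
Qed.

Definition computable_family B L (c : numbering B L) (p : nat -> formula L) :=
  computable_seq B 1 (fun s => form_num c (p (nth 0 s 0))).

(** A valid sentence whose code exceeds w: the membership test for a code k need only search w <
    k. *)
Definition padding L (w : nat) : formula L := FEx w (FEq (TVar w) (TVar w)).

Lemma fv_padding L w : fv (padding L w) = [::].
Proof. by rewrite /= eqxx. Qed.

Lemma lt_num_padding B L (c : numbering B L) w : w < form_num c (padding L w).
Proof.
by have /and4P[] := ltn_code [:: 4; w; form_num c (FEq (@TVar L w) (TVar w))].
Qed.

(* Craig's trick: the padding makes the range of a computable family of
   formulas computable. *)
Lemma computable_padded B L (c : numbering B L) (p : nat -> formula L) :
  computable_family c p ->
  computable_set c [set phi | exists w, phi = FAnd (p w) (padding L w)].
Proof.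
move=> cp.
have cF : computable_seq B 1
    (fun s => form_num c (FAnd (p (nth 0 s 0)) (padding L (nth 0 s 0)))).
  have v0 : computable_seq B 1 (fun s => nth 0 s 0) by apply: cp_var.
  have ct : computable_seq B 1 (fun s =>
      form_num c (FEq (@TVar L (nth 0 s 0)) (TVar (nth 0 s 0)))).
    have cv : computable_seq B 1 (fun s => code [:: 0; nth 0 s 0]).
      exact: cp_code_cons (cp_cst _ _ _) (cp_code_cons v0 (cp_code_nil _ _)).
    exact: cp_code_cons (cp_cst _ _ _)
      (cp_code_cons cv (cp_code_cons cv (cp_code_nil _ _))).
  have cpad : computable_seq B 1 (fun s => form_num c (padding L (nth 0 s 0))).
    exact: cp_code_cons (cp_cst _ _ _)
      (cp_code_cons v0 (cp_code_cons ct (cp_code_nil _ _))).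
  exact: cp_code_cons (cp_cst _ _ _)
    (cp_code_cons cp (cp_code_cons cpad (cp_code_nil _ _))).
pose h w := form_num c (FAnd (p w) (padding L w)).
pose chi k : nat := has (fun w => h w == k) (iota 0 k).
exists (fun x : 1.-tuple nat => chi (nth 0 x 0)).
  have hp : computable_seq B 2 (fun t => h (nth 0 t 0) == nth 0 t 1).
    by apply: cp_eq; [apply: (cp_op1 (f := h)) cF _|]; apply: cp_var.
  exact: (cp_has (p := fun t => h (nth 0 t 0) == nth 0 t 1) hp (cp_var _ (ltn0Sn 0))).
move=> k; rewrite /= /chi; split.
  by case: hasP => // -[w _ /eqP <-] _; exists (FAnd (p w) (padding L w)); first by exists w.
move=> [_ [w ->] hk]; suff -> : has (fun w => h w == k) (iota 0 k) by [].
apply/hasP; exists w; last exact/eqP.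
rewrite mem_iota add0n -hk /=; apply: ltn_trans (lt_num_padding c w) _.
by have /and4P[] := ltn_code [:: 3; form_num c (p w); form_num c (padding L w)].
Qed.

Lemma rec_saturated_uniform B L (c : numbering B L) (M : structure L)
    (d : {X : set (1.-tuple M) | @D L M 1 X} -> M) :
  comp_unif_definable c d -> rec_saturated c M -> inhabited (uniform d).
Proof.
move=> [F [a /cp_computable ha aF] hF] [_ hM].
have v0 : computable_seq B 1 (fun s => nth 0 s 0) by apply: cp_var.
have [f cf [f1 f2]] := form_enum c; have [G hG] := choice f1; constructor.
apply: (@Uniform _ _ d nat (computable_family c)).
- by move=> p; apply: cp_cst.
- by move=> p hp; exact: cp_code_cons (cp_cst _ _ _) (cp_code_cons hp (cp_code_nil _ _)).
- move=> p q hp hq; exact: cp_code_cons (cp_cst _ _ _)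
    (cp_code_cons hp (cp_code_cons hq (cp_code_nil _ _))).
- move=> i p hp; exact: cp_code_cons (cp_cst _ _ _)
    (cp_code_cons (cp_cst _ _ i) (cp_code_cons hp (cp_code_nil _ _))).
- move=> K p hp.
  have h w := @close_exs L M K (form_num c (p w)) (p w)
    (fun i ip => ltn_addl K (fv_lt_num c ip)).
  exists (fun w => exs (iota K (form_num c (p w))) (p w)).
  split=> [|w|w]; [|by case: (h w)..].
  have hs : computable_seq B 3 (fun s => code [:: 4; nth 0 s 0; nth 0 s 1]).
    apply: cp_code_cons (cp_cst _ _ _) (cp_code_cons (cp_var _ _)
      (cp_code_cons (cp_var _ _) (cp_code_nil _ _))) => //.
  apply: cp_ext (cp_foldr_iota K hs hp hp) => s _.
  by elim: (iota K _) => // i l IH; rewrite [LHS]/= IH.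
(* An index codes a sequence of numbers, whose i-th entry is the position of the i-th formula in the
   enumeration. *)
- exists (fun i w => G (cnth w i)) => [i|r t].
    apply: cp_ext (cp_op1 cf (cp_cnth v0 (cp_cst _ _ i))) => s _.
    by rewrite hG.
  have /choice[ws hws] i := f2 (t i).
  exists (code (mkseq ws r)) => i ir; apply: (@form_num_inj _ _ c).
  by rewrite hG /cnth codeK nth_mkseq.
- move=> p hp; exists (F \o p) => [|w].
    by apply: cp_ext (cp_op1 (f := fun k => a [tuple k]) ha hp) => s _; apply: aF.
  have [K hK] := seq_ub (fv (p w)); apply: (hF K _ _).2 => i /hK; lia.
- move=> n K e p hp fp hpx.
  (* Still equivalent to the negation of [p w], but the set of all [q w] is computable and not
     merely enumerable. *)
  pose q w := FAnd (FNot (p w)) (padding L w).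
  pose P := [set phi | exists w, phi = q w].
  apply: (@compact_cover L M n e _ p q [set phie | P phie.1 /\ phie.2 = e]) => //.
  + by move=> w x /=; split=> [[]//|h]; split=> //; exists (e 0).
  + move=> [phi e'] /=; split=> [[[w ->] ->]|[w [-> ->]]]; first by exists w.
    by split=> //; exists w.
  apply: (hM n K e P).
    apply: (@computable_padded _ _ c (fun w => FNot (p w))).
    exact: cp_code_cons (cp_cst _ _ _) (cp_code_cons hp (cp_code_nil _ _)).
  move=> _ [w ->] i; rewrite [fv _]/= mem_cat => /orP[/fp//|].
  by rewrite -[X in _ \in X]/(fv (padding L w)) fv_padding.
Qed.

Lemma uniform_comprehension_choice L (M : structure L)
    (d : {X : set (1.-tuple M) | @D L M 1 X} -> M) :
  inhabited (uniform d) -> arith_comprehension (so_of d) ->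
  Delta11_comprehension (so_of d) /\
  (Sigma11_choice (so_of d) <-> definable_skolem M).
Proof.
move=> [U] hN; split; first exact: Delta11_comprehension_uniform U.
by split; [apply: skolem_of_choice|apply: choice_of_skolem U hN].
Qed.

Theorem theorem4p9 (L : language) (M : structure L)
  (d : {X : set (1.-tuple M) | @D L M 1 X} -> M) (B : nat -> bool) :
  (ABL0 (so_of d) ->
    [/\ unif_definable d -> saturated M -> Delta11_BL0 (so_of d),
        unif_definable d -> saturated M ->
          (Sigma11_LB0 (so_of d) <-> definable_skolem M),
        forall c : numbering B L,
          comp_unif_definable c d -> rec_saturated c M ->
          Delta11_BL0 (so_of d) &
        forall c : numbering B L,
          comp_unif_definable c d -> rec_saturated c M ->
          (Sigma11_LB0 (so_of d) <-> definable_skolem M)]) /\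
  (AHP0 (so_of d) ->
    [/\ unif_definable d -> saturated M -> Delta11_HP0 (so_of d),
        unif_definable d -> saturated M ->
          (Sigma11_PH0 (so_of d) <-> definable_skolem M),
        forall c : numbering B L,
          comp_unif_definable c d -> rec_saturated c M ->
          Delta11_HP0 (so_of d) &
        forall c : numbering B L,
          comp_unif_definable c d -> rec_saturated c M ->
          (Sigma11_PH0 (so_of d) <-> definable_skolem M)]).
Proof.
(* A is instantiated with Basic Law V and with Hume's Principle, which makes the two halves one
   argument. *)
have key A : A /\ arith_comprehension (so_of d) -> inhabited (uniform d) ->
    (A /\ Delta11_comprehension (so_of d)) /\
    ((A /\ arith_comprehension (so_of d)) /\ Sigma11_choice (so_of d) <->
      definable_skolem M).
  by move=> [hA hN] /uniform_comprehension_choice/(_ hN)[hD hC]; tauto.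
split=> hN; split=> [hd hM|hd hM|c hd hM|c hd hM];
  by [have [] := key _ hN (saturated_uniform hd hM) |
      have [] := key _ hN (rec_saturated_uniform hd hM)].
Qed.
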